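(* Let $f\colon[0,1]\to[0,1]$ be a continuous map of Sharkovskii type 1. Then the following four quantities are equal (and they belong to $\mathbb N_0\cup\{\infty\}$): (a) the polynomial entropy $h_{\mathrm{pol}}(f)$; (b) the supremum of the lengths of chains of essential intervals for $f$; (c) the supremum of the orders of one-way horseshoes of $f$ and its iterates $f^n$, $n\ge 1$; (d) the supremum of the orders of one-way horseshoes of $f$ and its iterates $f^n$, $n\geq 1$, consisting of closed intervals. Consequently, if $h_{\mathrm{pol}}(f)$ is finite, then it is a nonnegative integer.
   Context: The supremum of the empty set is taken to be $0$. Sharkovskii type 1 means that all periodic points of $f$ are fixed points. $\mathrm{Fix}(f)$ denotes the set of fixed points. For $J\subseteq[0,1]$, $\mathrm{Orb}(J)=\bigcup_{n=0}^\infty f^n(J)$. Chains: for $f$ of Sharkovskii type 1, an interval $I=(a,b)$ with $a<b$, $a,b\in\mathrm{Fix}(f)$ and $I\cap\mathrm{Fix}(f)=\emptyset$ is called an essential interval. A chain of essential intervals of length $\ell\ge 1$ is an indexed family $I_1,\dots,I_\ell$ of distinct essential intervals such that $\mathrm{Orb}(I_i)\supseteq I_{i+1}$ for all $i<\ell$. One-way horseshoe: for a continuous map $g\colon[0,1]\to[0,1]$, a one-way horseshoe of order $\ell\ge1$ for $g$ is an indexed family $A_1,\dots,A_\ell$ of pairwise disjoint compact sets such that $A_\ell$ contains a non-recurrent point of $g$ and $g(A_i)\supseteq A_j$ for all $1\le i\le j\le\ell$. A point $x$ is recurrent for $g$ if for every $\varepsilon>0$ there is $n\ge1$ with $|g^n(x)-x|<\varepsilon$;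 otherwise it is non-recurrent. Polynomial entropy: $S$ is $(n,\varepsilon,f)$-separated if $\max_{0\le i\le n-1}|f^i(x)-f^i(y)|>\varepsilon$ for any distinct $x,y\in S$; $\mathrm{sep}(n,\varepsilon,f)$ is the maximal cardinality of an $(n,\varepsilon,f)$-separated set; $h_{\mathrm{pol}}(f)=\lim_{\varepsilon\to0}\limsup_{n\to\infty}\frac{\log\mathrm{sep}(n,\varepsilon,f)}{\log n}$. *)

(* Defs.v *)
From HB Require Import structures.
From mathcomp Require Import all_boot all_order all_algebra.
From mathcomp Require Import all_classical all_reals all_analysis.

Set Implicit Arguments.
Unset Strict Implicit.
Unset Printing Implicit Defensive.

Import Order.TTheory GRing.Theory Num.Theory.
Import numFieldNormedType.Exports.

Local Open Scope classical_set_scope.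
Local Open Scope ring_scope.

(* A map [0,1] -> [0,1] is represented by a total f : R -> R sending [0,1]
   into itself; every notion below depends only on the values of f on [0,1]. *)
Definition unit_itv (R : realType) : set R := `[0, 1].
Arguments unit_itv : clear implicits.

Definition interval_map (R : realType) (f : R -> R) : Prop :=
  set_fun (unit_itv R) (unit_itv R) f /\ {within unit_itv R, continuous f}.

Definition Fix (R : realType) (f : R -> R) : set R :=
  [set x | unit_itv R x /\ f x = x].

Definition periodic_point (R : realType) (f : R -> R) (x : R) : Prop :=
  unit_itv R x /\ exists n : nat, (1 <= n)%N /\ iter n f x = x.

Definition sharkovskii_type1 (R : realType) (f : R -> R) : Prop :=
  forall x, periodic_point f x -> Fix f x.

Definition Orb (R : realType) (f : R -> R) (J : set R) : set R :=
  \bigcup_(n in [set: nat]) (iter n f @` J).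

Definition essential_interval (R : realType) (f : R -> R) (I : set R) : Prop :=
  exists a b : R, [/\ a < b, Fix f a, Fix f b,
    I = `]a, b[%classic & I `&` Fix f = set0].

Definition chain (R : realType) (f : R -> R) (l : nat) (I : 'I_l -> set R)
    : Prop :=
  [/\ (1 <= l)%N,
      forall i, essential_interval f (I i),
      injective I
    & forall i j : 'I_l, j = i.+1 :> nat -> I j `<=` Orb f (I i)].

Definition recurrent (R : realType) (g : R -> R) (x : R) : Prop :=
  forall e : R, 0 < e -> exists n : nat, (1 <= n)%N /\ `|iter n g x - x| < e.

(* The indices 1, ..., l of the family are shifted to 0, ..., l - 1. *)
Definition one_way_horseshoe (R : realType) (g : R -> R) (l : nat)
    (A : 'I_l -> set R) : Prop :=
  [/\ (1 <= l)%N,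
      forall i, A i `<=` unit_itv R /\ compact (A i),
      trivIset [set: 'I_l] A,
      (forall i : 'I_l, i.+1 = l -> exists2 x, A i x & ~ recurrent g x)
    & forall i j : 'I_l, (i <= j)%N -> A j `<=` g @` A i].

Definition closed_interval (R : realType) (J : set R) : Prop :=
  exists a b : R, a <= b /\ J = `[a, b]%classic.

(* Supremum in [0, +oo]: the supremum of the empty set is 0, whereas
   [ereal_sup set0] is -oo. *)
Definition nat_sup (R : realType) (A : set nat) : \bar R :=
  if A == set0 then 0%E else ereal_sup [set (k%:R)%:E | k in A].
Arguments nat_sup : clear implicits.

Definition chain_lengths (R : realType) (f : R -> R) : set nat :=
  [set l | exists I : 'I_l -> set R, chain f I].

Definition horseshoe_orders (R : realType) (f : R -> R) : set nat :=
  [set l | exists n : nat, (1 <= n)%N /\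
    exists A : 'I_l -> set R, one_way_horseshoe (iter n f) A].

Definition itv_horseshoe_orders (R : realType) (f : R -> R) : set nat :=
  [set l | exists n : nat, (1 <= n)%N /\
    exists A : 'I_l -> set R, one_way_horseshoe (iter n f) A /\
      forall i, closed_interval (A i)].

Definition separated (R : realType) (n : nat) (e : R) (f : R -> R) (S : set R)
    : Prop :=
  S `<=` unit_itv R /\
  forall x y, S x -> S y -> x <> y ->
    e < \big[Num.max/0]_(i < n) `|iter i f x - iter i f y|.

(* Maximal cardinality of a separated set, as an extended real. *)
Definition sep (R : realType) (n : nat) (e : R) (f : R -> R) : \bar R :=
  nat_sup R [set k | exists S : set R,
    separated n e f S /\ (S #= [set: 'I_k])%card].

(* The terms n = 0, 1, where ln n = 0, are irrelevant for the limsup. *)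
Definition sep_growth (R : realType) (f : R -> R) (e : R) : \bar R :=
  limn_esup (fun n : nat => (lne (sep n e f) * ((ln n%:R)^-1)%:E)%E).

Definition hpol (R : realType) (f : R -> R) : \bar R :=
  lim (sep_growth f e @[e --> 0^'+]).

Definition natbar (R : realType) : set (\bar R) :=
  [set x | x = +oo%E \/ exists k : nat, x = (k%:R)%:E].
Arguments natbar : clear implicits.

Lemma nat_sup_le (R : realType) (A B : set nat) :
  A `<=` B -> (nat_sup R A <= nat_sup R B)%E.
Proof.
move=> AB; rewrite /nat_sup; case: eqP => [_|A0]; case: eqP => [B0|B0] //.
- have /set0P[k Bk] : B != set0 by apply/eqP.
  apply: (@le_trans _ _ (k%:R)%:E); first by rewrite lee_fin ler0n.
  by apply: ereal_sup_ubound; exists k.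
- by case: A0; rewrite -subset0 -B0.
- apply: ge_ereal_sup => _ [k Ak <-]; apply: ereal_sup_ubound.
  by exists k => //; exact: AB.
Qed.

Lemma le_lne (R : realType) : {homo @lne R : x y / (x <= y)%E}.
Proof.
move=> x y xy; have [x0|x0] := leP x 0%E; first by rewrite le0_lneNy ?leNye.
case: x xy x0 => [x| |] // xy x0; last first.
  by move: xy; rewrite leye_eq => /eqP ->.
case: y xy => [y| |] // xy; last by rewrite /= leey.
rewrite lee_fin in xy; rewrite lte_fin in x0.
have y0 : 0 < y by exact: lt_le_trans xy.
by rewrite !lne_EFin// lee_fin ler_ln.
Qed.

Lemma sep_growth_nonincreasing (R : realType) (f : R -> R) (d e : R) :
  d <= e -> (sep_growth f e <= sep_growth f d)%E.
Proof.
move=> de; apply: le_ereal_inf_tmp => _ [V FV <-].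
apply: le_trans.
  by apply: ereal_inf_lbound; exists V.
apply: ge_ereal_sup => _ [n Vn <-].
apply: (@le_trans _ _ (lne (sep n d f) * ((ln n%:R)^-1)%:E)%E); last first.
  by apply: ereal_sup_ubound; exists n.
apply: lee_wpmul2r.
  rewrite lee_fin invr_ge0; case: n {Vn} => [|n]; first by rewrite ln0// invr0.
  by rewrite ln_ge0// ler1n.
apply: le_lne; apply: nat_sup_le => k [S [[S01 Se] Sk]].
exists S; split=> //; split=> // x y Sx Sy xy.
exact: le_lt_trans de (Se x y Sx Sy xy).
Qed.

(* The limit defining [hpol] exists for every f. *)
Lemma cvg_sep_growth (R : realType) (f : R -> R) :
  cvg (sep_growth f e @[e --> 0^'+]).
Proof.
apply: nonincreasing_at_right_is_cvge; near=> x => d e _ _.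
exact: sep_growth_nonincreasing.
Unshelve. all: by end_near. Qed.

(* Main.v *)
Require Import Defs.
From HB Require Import structures.
From mathcomp Require Import all_boot all_order all_algebra.
From mathcomp Require Import all_classical all_reals all_analysis.
From mathcomp Require Import ring lra zify.

Set Implicit Arguments.
Unset Strict Implicit.
Unset Printing Implicit Defensive.

Import Order.TTheory GRing.Theory Num.Theory.
Import numFieldNormedType.Exports.

Local Open Scope classical_set_scope.
Local Open Scope ring_scope.

(* Let f have no periodic points other than fixed points. If f x > x, then all
   later iterates of x are > x (and symmetrically), so every nonfixed point is
   wandering and, by compactness, an orbit visits the complement of an
   h-neighbourhood of Fix f a bounded number of times. In an essential interval
   ]a, b[ the points move away from one endpoint, its source, a say; the union
   of {a} and the orbit of ]a, b[ is an invariant interval starting at a.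

   A chain yields a horseshoe: short closed intervals starting at the sources
   expand under iteration, and cover the later ones. A horseshoe of order l
   yields m^l separated points in time l * m, distinguished by the times of
   transition A_1 -> ... -> A_l -> (nonrecurrent point).

   If there is no chain of length l + 1, then an orbit staying close to Fix f
   stays within eps of its entry point (a longer drift would cross many linked
   small gaps), and a long stay followed by an excursion passes near the source
   of an essential interval; the essential intervals so obtained along an orbit
   form a chain, so there are at most l such stays. Up to eps, an orbit of length
   n is described by a bounded amount of data and the durations of these stays,
   which gives O(n^l) separated points. *)

(** * Compactness of the unit interval *)

(** The supremum of the [t] such that [P] holds on [[0, t]] has a neighbourhood satisfying [P], so
    it cannot stop short of 1. This takes the place of finite subcovers below. *)
Lemma itv01_local (R : realType) (P : set R -> Prop) :
  (forall A B, A `<=` B -> P B -> P A) ->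
  (forall A B, P A -> P B -> P (A `|` B)) ->
  (forall x, 0 <= x <= 1 -> exists e : R, 0 < e /\ P [set y | `|y - x| < e]) ->
  P [set y | 0 <= y <= 1].
Proof.
move=> Pmono PU Ploc.
pose E := [set t : R | 0 <= t <= 1 /\ P [set y | 0 <= y <= t]].
have E0 : E 0.
  split; first by lra.
  have [|e [e0 Pe]] := Ploc 0; first by lra.
  apply: Pmono Pe => y /= y0; rewrite ltr_distl; lra.
have Eub : ubound E 1 by move=> t [] /andP[].
have Esup : has_sup E by split; [exists 0|exists 1].
have s0 : 0 <= sup E by apply: ub_le_sup => //; exists 1.
have s1 : sup E <= 1 by apply: ge_sup => //; exists 0.
have [|e [e0 Pe]] := Ploc (sup E); first by apply/andP.
have [t Et ts] := sup_adherent e0 Esup.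
have [t01 Pt] := Et.
have Pn u : u < sup E + e -> P [set y | 0 <= y <= u].
  move=> ue; apply: Pmono (PU _ _ Pt Pe) => y /= yu.
  case: (lerP y t) => yt; [left; lra|right].
  by rewrite /= ltr_distl; lra.
have [s1e|s1e] := ltP 1 (sup E + e); first exact: Pn.
have : E (sup E + e / 2).
  split; first by apply/andP; split; lra.
  apply: Pn; lra.
move=> /(ub_le_sup (ex_intro _ _ Eub)) ; lra.
Qed.

Lemma iterf (T : Type) (f : T -> T) n x : iter n f (f x) = f (iter n f x).
Proof. by rewrite -iterSr. Qed.

(** * The hypotheses in epsilon-delta form, and reflection *)

Record type1_map (R : realType) (f : R -> R) : Prop := Type1Map {
  t1_stab : forall x, 0 <= x <= 1 -> 0 <= f x <= 1;
  t1_uc : forall e, 0 < e -> exists d, 0 < d /\ forall x y,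
    0 <= x <= 1 -> 0 <= y <= 1 -> `|x - y| < d -> `|f x - f y| < e;
  t1_per : forall n x, 0 <= x <= 1 -> iter n.+1 f x = x -> f x = x }.

Lemma within_contP (R : realType) (f : R -> R) a b :
  {within `[a, b], continuous f} <-> forall x, a <= x <= b -> forall e, 0 < e ->
    exists d, 0 < d /\ forall y, a <= y <= b -> `|x - y| < d -> `|f x - f y| < e.
Proof.
rewrite subspace_continuousP; split=> H x xab.
  move=> e e0; have /H/cvgrPdist_lt/(_ e e0) : `[a, b]%classic x.
    by rewrite /= in_itv.
  rewrite near_withinE => -[d /= d0 dP]; exists d; split => // y yab xy.
  by apply: dP => //=; rewrite in_itv.
apply/cvgrPdist_lt => e e0; rewrite near_withinE.
move: xab; rewrite /= in_itv => /H/(_ e e0)[d [d0 dP]].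
exists d => //= y xy; rewrite in_itv => yab; exact: dP.
Qed.

Lemma type1_mapP (R : realType) (f : R -> R) :
  interval_map f -> sharkovskii_type1 f -> type1_map f.
Proof.
move=> [fI /within_contP fc] fs; split.
- by move=> x x01; have := fI x; rewrite /unit_itv /= !in_itv; apply.
- move=> e e0.
  pose P (J : set R) := exists d, 0 < d /\ forall x y, J x ->
    0 <= x <= 1 -> 0 <= y <= 1 -> `|x - y| < d -> `|f x - f y| < e.
  have [||x x01|d [d0 dP]] := @itv01_local _ P.
  + move=> A B AB [d [d0 dP]]; exists d; split=> // x y /AB; exact: dP.
  + move=> A B [d [d0 dP]] [d' [d'0 d'P]]; exists (Num.min d d').
    split; first by rewrite lt_min d0 d'0.
    by move=> x y AB x01 y01; rewrite lt_min => /andP[]; case: AB; auto.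
  + have [d [d0 dP]] := fc _ x01 (e / 2) ltac:(lra).
    exists (d / 2); split; first by lra.
    exists (d / 2); split; first by lra.
    move=> y z /= yx y01 z01 yz.
    have := dP y y01; have := dP z z01.
    move: yx yz; rewrite !ltr_distl => yx yz /(_ ltac:(lra)) h1 /(_ ltac:(lra)) h2.
    lra.
  + exists d; split=> // x y x01; exact: dP.
- move=> n x x01 h; have [|//] := fs x.
  split; first by rewrite /unit_itv /= in_itv.
  by exists n.+1.
Qed.

(** Conjugation by the reflection of the interval turns results on motion to the right into results
    on motion to the left. *)
Definition reflect_map (R : realType) (f : R -> R) (x : R) : R := 1 - f (1 - x).

Lemma iter_reflect (R : realType) (f : R -> R) n x :
  iter n (reflect_map f) x = 1 - iter n f (1 - x).
Proof.
by elim: n => [|n IH] /=; [ring|rewrite IH /reflect_map; congr (1 - f _); ring].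
Qed.

Lemma type1_reflect (R : realType) (f : R -> R) :
  type1_map f -> type1_map (reflect_map f).
Proof.
move=> [fI fu fp]; split.
- by move=> x x01; rewrite /reflect_map; have := fI (1 - x) ltac:(lra); lra.
- move=> e /fu[d [d0 dP]]; exists d; split=> // x y x01 y01 xy.
  rewrite /reflect_map; have := dP (1 - y) (1 - x) ltac:(lra) ltac:(lra).
  move: xy; rewrite !ltr_distl => xy /(_ ltac:(lra)); lra.
- move=> n x x01; rewrite iter_reflect => h.
  have := fp n (1 - x) ltac:(lra) ltac:(lra); rewrite /reflect_map; lra.
Qed.

(** * Intermediate values and the direction of orbits *)

Section Type1.
Variables (R : realType) (f : R -> R) (ft : type1_map f).
Implicit Types x y z a b : R.

Lemma iter_stab n x : 0 <= x <= 1 -> 0 <= iter n f x <= 1.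
Proof. by move=> x01; elim: n => //= n; exact: t1_stab. Qed.

Lemma iter_uc n e : 0 < e -> exists d, 0 < d /\ forall x y,
  0 <= x <= 1 -> 0 <= y <= 1 -> `|x - y| < d -> `|iter n f x - iter n f y| < e.
Proof.
elim: n e => [|n IH] e e0; first by exists e.
have [d [d0 dP]] := t1_uc ft e0; have [d' [d'0 d'P]] := IH d d0.
exists d'; split=> // x y x01 y01 /(d'P _ _ x01 y01) /=.
by apply: dP; exact: iter_stab.
Qed.

Lemma iter_cont n a b : 0 <= a -> b <= 1 -> {within `[a, b], continuous (iter n f)}.
Proof.
move=> a0 b1; apply/within_contP => x xab e /(iter_uc n)[d [d0 dP]].
exists d; split=> // y yab; apply: dP; lra.
Qed.

Lemma iter_IVT n a b v : 0 <= a -> a <= b -> b <= 1 ->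
  iter n f a <= v <= iter n f b \/ iter n f b <= v <= iter n f a ->
  exists c, a <= c <= b /\ iter n f c = v.
Proof.
move=> a0 ab b1 h.
have [||c] := @IVT _ (iter n f) a b v ab; first exact: iter_cont.
  by case: h => h; [rewrite minEle maxEle|rewrite minEge maxEge]; case: ifP; lra.
by rewrite in_itv /= => cab <-; exists c.
Qed.

Lemma iter_fix n x : f x = x -> iter n f x = x.
Proof. by move=> fx; elim: n => //= n ->. Qed.

(** The intermediate value theorem gives a fixed point of an iterate, which is periodic and
    therefore fixed by [f]. *)
Lemma iter_fixed_between n a b : 0 <= a -> a <= b -> b <= 1 ->
  a <= iter n.+1 f a /\ iter n.+1 f b <= b \/
  iter n.+1 f a <= a /\ b <= iter n.+1 f b ->
  exists c, a <= c <= b /\ f c = c.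
Proof.
move=> a0 ab b1 h.
pose g x := iter n.+1 f x - x.
have [||c] := @IVT _ g a b 0 ab.
- apply/within_contP => x xab e e0.
  have [d [d0 dP]] := iter_uc n.+1 (e := e / 2) ltac:(lra).
  exists (Num.min d (e / 2)); split; first by rewrite lt_min; lra.
  move=> y yab; rewrite lt_min => /andP[/dP].
  rewrite /g !ltr_distl => /(_ ltac:(lra) ltac:(lra)); lra.
- by case: h => h; [rewrite minEge maxEge|rewrite minEle maxEle];
    case: ifP; rewrite /g; lra.
- rewrite in_itv /= => cab /eqP; rewrite subr_eq0 => /eqP gc.
  by exists c; split=> //; apply: (t1_per ft) gc; lra.
Qed.

Lemma left_fix x : 0 <= x <= 1 -> (exists p, 0 <= p <= x /\ f p = p) ->
  exists a, [/\ 0 <= a <= x, f a = a & forall p, a < p <= x -> f p <> p].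
Proof.
move=> x01 [p0 [p0x fp0]].
pose E := [set p | 0 <= p <= x /\ f p = p].
have Eub : ubound E x by move=> p [] /andP[].
have Esup : has_sup E by split; [exists p0|exists x].
have s0 : 0 <= sup E by apply: (@le_trans _ _ p0); [lra|apply: ub_le_sup => //; exists x].
have s1 : sup E <= x by apply: ge_sup => //; exists p0.
exists (sup E); split; first by apply/andP.
  apply/eqP/negPn/negP => /eqP ns.
  (* A fixed point [p] of [E] close to [sup E] is within [e / 2] of both [sup E] and [f (sup E)],
     which are [e] apart. *)
  pose e := `|f (sup E) - sup E|.
  have e0 : 0 < e / 2 by rewrite divr_gt0// normr_gt0 subr_eq0; apply/eqP.
  have [d [d0 dP]] := t1_uc ft e0.
  have [|p Ep ps] := @sup_adherent _ E (Num.min d (e / 2)) _ Esup.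
    by rewrite lt_min d0 e0.
  have [p01 fp] := Ep.
  have pE : p <= sup E by apply: ub_le_sup => //; exists x.
  have {ps} : sup E - p < Num.min d (e / 2) by lra.
  rewrite lt_min => /andP[h1 h2].
  have := dP (sup E) p ltac:(lra) ltac:(lra); rewrite fp ger0_norm; last by lra.
  move=> /(_ h1); rewrite /e in h2 *; case: (lerP 0 (f (sup E) - sup E)) => h;
  [rewrite ger0_norm in h2 * => //|rewrite ltr0_norm in h2 * => //];
  rewrite ltr_distl; lra.
move=> p psx fp; have : p <= sup E; last by lra.
by apply: ub_le_sup; [exists x|split=> //; lra].
Qed.

(* A nonfixed point moving right never returns to its left. Otherwise, starting
   near the left end of its component of the complement of the fixed points
   (or at [0]) the iterates increase, and the intermediate value theorem yields
   a periodic point in the component. *)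
Lemma iter_gt x n : 0 <= x <= 1 -> x < f x -> x < iter n.+1 f x.
Proof.
move=> x01 xfx; rewrite ltNge; apply/negP => h.
have {}h : iter n.+1 f x < x.
  rewrite lt_neqAle h andbT; apply/eqP => /(t1_per ft x01); lra.
have nofix z : 0 <= z <= x -> (forall p, z <= p <= x -> f p <> p) ->
    ~ z < iter n.+1 f z.
  move=> zx zp hz; have [||||c [cx fc]] := @iter_fixed_between n z x; try lra.
  exact: zp cx fc.
have [ex|nex] := pselect (exists p, 0 <= p <= x /\ f p = p); last first.
  apply: (nofix 0); first by lra.
    by move=> p px fp; apply: nex; exists p; split.
  have /andP[] := iter_stab n.+1 (x := 0) ltac:(lra).
  rewrite le_eqVlt => /orP[/eqP e _|//].
  have := t1_per ft (x := 0) ltac:(lra) (esym e).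
  by move=> f0; case: nex; exists 0; split=> //; lra.
have [a [ax fa na]] := left_fix x01 ex.
have ax' : a < x.
  by rewrite lt_neqAle; apply/andP; split; [apply/eqP=> e; move: fa; rewrite e|]; lra.
have fup z : a < z <= x -> z < f z.
  move=> zx; rewrite ltNge; apply/negP => fz.
  have [||||c [cx fc]] := @iter_fixed_between 0 z x; rewrite /=; try lra.
  by apply: na fc; lra.
have near m : exists d, 0 < d /\ forall z, a < z < a + d -> z <= x ->
    z < iter m.+1 f z <= x.
  elim: m => [|m [d [d0 dP]]].
    have [d [d0 dP]] := iter_uc 1 (e := x - a) ltac:(lra).
    exists d; split=> // z zd zx; have := dP a z ltac:(lra) ltac:(lra).
    have := fup z ltac:(lra); rewrite /= fa !ltr_distl => ? /(_ ltac:(lra)); lra.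
  have [d' [d'0 d'P]] := iter_uc m.+2 (e := x - a) ltac:(lra).
  exists (Num.min d d'); split; first by rewrite lt_min d0.
  move=> z /andP[az]; rewrite -ltrBlDl lt_min => zd zx.
  have := dP z ltac:(lra) zx; have := d'P a z ltac:(lra) ltac:(lra).
  rewrite (iter_fix m.+2 fa) !ltr_distl => /(_ ltac:(lra)) h1 h2.
  have := fup (iter m.+1 f z) ltac:(lra); move: h1; rewrite [iter m.+2 f z]/=; lra.
have [d [d0 dP]] := near n.
have [zd zx] : a + Num.min (d / 2) (x - a) < a + d /\ a + Num.min (d / 2) (x - a) <= x.
  by rewrite minEle; case: ifP; lra.
have az : a < a + Num.min (d / 2) (x - a) by rewrite ltrDl lt_min; lra.
apply: (nofix (a + Num.min (d / 2) (x - a))); first by lra.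
  by move=> p px; apply: na; lra.
by have := dP _ _ zx; rewrite az zd => /(_ isT) /andP[].
Qed.

End Type1.

(** * Nonfixed points are wandering *)

Section Wandering.
Variables (R : realType) (f : R -> R) (ft : type1_map f).
Implicit Types x y z a b : R.

Lemma iter_lt x n : 0 <= x <= 1 -> f x < x -> iter n.+1 f x < x.
Proof.
move=> x01 fx; have := @iter_gt _ _ (type1_reflect ft) (1 - x) n ltac:(lra).
by rewrite iter_reflect /reflect_map subKr; move=> /(_ ltac:(lra)); lra.
Qed.

Lemma iter_ge x n : 0 <= x <= 1 -> x <= f x -> x <= iter n f x.
Proof.
move=> x01; rewrite le_eqVlt => /orP[/eqP e|]; first by rewrite iter_fix.
by case: n => // n /(@iter_gt _ _ ft _ n x01)/ltW.
Qed.

Lemma iter_le x n : 0 <= x <= 1 -> f x <= x -> iter n f x <= x.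
Proof.
move=> x01; rewrite le_eqVlt => /orP[/eqP e|]; first by rewrite iter_fix.
by case: n => // n /(@iter_lt _ n x01)/ltW.
Qed.

(* Otherwise some [q] in [[z, w]] has [f q = w > q] and [f (f q) = z <= q],
   against [iter_gt]. *)
Lemma two_step_lt z w : 0 <= z -> z < w -> w <= 1 -> f w = z -> f z < w.
Proof.
move=> z0 zw w1 fw; rewrite ltNge; apply/negP => wfz.
have [||||q [qzw fq]] := @iter_IVT _ _ ft 1 z w w; rewrite /= ?fw; try lra.
move: fq => /= fq; have qw : q < w.
  by rewrite lt_neqAle; apply/andP; split; [apply/eqP => qw; rewrite qw fw in fq|]; lra.
by have := @iter_gt _ _ ft q 1 ltac:(lra); rewrite /= fq fw => /(_ qw); lra.
Qed.

(* Let [y] and its first later iterate [z] below [x + e] be close to [x]. In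
   between, the orbit decreases from [f y] to the preimage [w] of [z], and [w]
   stays away from [f x], so that [f z > w], against [two_step_lt]. *)
Lemma wandering_gt x : 0 <= x <= 1 -> x < f x -> exists e, 0 < e /\
  forall y, 0 <= y <= 1 -> `|y - x| < e -> forall n, e <= `|iter n.+1 f y - x|.
Proof.
move=> x01 xfx.
have fx01 := t1_stab ft x01.
have xffx : x < f (f x) by exact: (@iter_gt _ _ ft x 1).
have [d [d0 dP]] := t1_uc ft (e := (f (f x) - x) / 2) ltac:(lra).
have [d1 [d10 d1P]] := t1_uc ft (e := Num.min d ((f x - x) / 2))
  ltac:(rewrite lt_min; lra).
have [e [e0 ed1 ex eff]] : exists e, [/\ 0 < e, e <= d1, e <= (f x - x) / 4
    & e <= (f (f x) - x) / 4].
  exists (Num.min d1 (Num.min ((f x - x) / 4) ((f (f x) - x) / 4))).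
  by rewrite !lt_min !ge_min !lexx ?orbT /=; split=> //; lra.
exists e; split=> // y y01 yx n0; rewrite leNgt; apply/negP => hn0.
have exn : exists n, iter n.+1 f y < x + e.
  by exists n0; move: hn0; rewrite ltr_distl => /andP[].
have := ex_minnP exn => -[n hn nmin] {n0 hn0 exn}.
have yd : `|y - x| < d1 by exact: lt_le_trans yx ed1.
have := d1P _ _ y01 x01 yd; rewrite lt_min => /andP[fyd fyx].
move: yx fyx; rewrite !ltr_distl => yx fyx.
have zy : y < iter n.+1 f y by apply: iter_gt => //; lra.
case: n hn nmin zy => [|m] hn nmin zy; first by rewrite /= in hn; lra.
have [w wE] : exists w, w = iter m.+1 f y by exists (iter m.+1 f y).
have [z wz] : exists z, f w = z by exists (f w).
have zE : iter m.+2 f y = z by rewrite -wz wE.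
rewrite zE in hn zy.
have w01 : 0 <= w <= 1 by rewrite wE; exact: iter_stab.
have z01 : 0 <= z <= 1 by rewrite -wz; exact: t1_stab.
have wx : x + e <= w.
  by rewrite leNgt wE; apply/negP => /nmin; rewrite ltnn.
have fy01 := t1_stab ft y01.
(* If instead [f y < w], then [f y] moves right and its orbit never falls back to [z]. *)
have wfy : w <= f y.
  rewrite leNgt; apply/negP => h; have : ~ f (f y) <= f y.
    by move=> /(iter_le m fy01); rewrite iterf -iterS -wE; lra.
  move=> /negP; rewrite -ltNge => /ltW /(iter_ge m.+1 fy01).
  by rewrite iterf -iterS zE; lra.
(* A point within [d] of [f x] is mapped close to [f (f x)], well above [z]. *)
have wfx : w <= f x - d.
  rewrite leNgt; apply/negP => h.
  have := dP w (f x) w01 fx01; rewrite wz !ltr_distl.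
  move: fyd; rewrite ltr_distl => fyd /(_ ltac:(lra)); lra.
have zd : `|z - x| < d1 by rewrite ltr_distl; lra.
have := d1P _ _ z01 x01 zd; rewrite lt_min ltr_distl => /andP[fz _].
by have := two_step_lt (z := z) (w := w) ltac:(lra) ltac:(lra) ltac:(lra) wz; lra.
Qed.

End Wandering.

(** * Bounded number of visits far from the fixed points *)

Section Visits.
Variables (R : realType) (f : R -> R) (ft : type1_map f).
Implicit Types x y z a b : R.

Lemma wandering x : 0 <= x <= 1 -> f x <> x -> exists e, 0 < e /\
  forall y, 0 <= y <= 1 -> `|y - x| < e -> forall n, e <= `|iter n.+1 f y - x|.
Proof.
move=> x01 /eqP; rewrite neq_lt => /orP[fx|xf]; last exact: wandering_gt.
have [||e [e0 eP]] := @wandering_gt _ _ (type1_reflect ft) (1 - x).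
- by lra.
- by rewrite /reflect_map subKr; lra.
exists e; split=> // y y01 yx n; have := eP (1 - y) ltac:(lra).
have -> : 1 - y - (1 - x) = - (y - x) by ring.
rewrite normrN => /(_ yx n); rewrite iter_reflect subKr.
have -> : 1 - iter n.+1 f y - (1 - x) = - (iter n.+1 f y - x) by ring.
by rewrite normrN.
Qed.

Definition away (r : R) (x : R) : Prop :=
  0 <= x <= 1 /\ forall p, 0 <= p <= 1 -> f p = p -> r <= `|x - p|.

Definition visits (A : R -> Prop) (x : R) (n : nat) : nat :=
  \sum_(i < n) `[< A (iter i f x) >].

Lemma visitsD A x m n : visits A x (m + n) = (visits A x m + visits A (iter m f x) n)%N.
Proof.
rewrite /visits big_split_ord /=; congr addn; apply: eq_bigr => i _.
by rewrite addnC iterD.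
Qed.

Lemma visits_le_sub (A B : R -> Prop) x n :
  (forall z, A z -> B z) -> (visits A x n <= visits B x n)%N.
Proof.
move=> AB; apply: leq_sum => i _; case: asboolP => // /AB Bi.
by rewrite asboolT.
Qed.

Lemma visits_le1 (A : R -> Prop) x n :
  (forall z k, 0 <= z <= 1 -> A z -> ~ A (iter k.+1 f z)) -> 0 <= x <= 1 ->
  (visits A x n <= 1)%N.
Proof.
move=> An; elim: n x => [|n IH] x x01; first by rewrite /visits big_ord0.
rewrite -add1n visitsD {1}/visits big_ord_recl big_ord0 /= addn0.
case: asboolP => Ax; last by rewrite IH// t1_stab.
rewrite /visits big1// => i _; rewrite asboolF// -iterSr; exact: An.
Qed.

(** Points within [r] of a fixed point are not counted, and a wandering neighbourhood of a nonfixed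
    point is visited at most once. These local bounds add up. *)
Lemma visits_away r : 0 < r -> exists M, forall x n, 0 <= x <= 1 ->
  (visits (away r) x n <= M)%N.
Proof.
move=> r0.
pose P (J : set R) := exists M, forall x n, 0 <= x <= 1 ->
  (visits (fun z => away r z /\ J z) x n <= M)%N.
have [||x x01|M MP] := @itv01_local _ P.
- move=> A B AB [M MP]; exists M => x n /(MP _ n); apply: leq_trans.
  by apply: visits_le_sub => z [? /AB].
- move=> A B [M MP] [N NP]; exists (M + N)%N => x n x01.
  apply: leq_trans (leq_add (MP x n x01) (NP x n x01)).
  rewrite -big_split /=; apply: leq_sum => i _.
  case: asboolP => // -[aw [Ai|Bi]].
    by rewrite (asboolT (conj aw Ai)).
  by rewrite (asboolT (conj aw Bi)) addn1.
- have [fx|fx] := pselect (f x = x).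
    exists r; split=> //; exists 0%N => y n y01.
    rewrite /visits big1// => i _; rewrite asboolF// => -[[_ /(_ _ x01 fx)]] /=.
    by rewrite leNgt => /negP.
  have [e [e0 eP]] := wandering x01 fx.
  exists e; split=> //; exists 1%N => y n y01; apply: visits_le1 => //.
  by move=> z k z01 [_ /= /eP zP] [_] /=; rewrite ltNge zP.
- exists M => x n x01; apply: leq_trans (MP x n x01).
  by apply: visits_le_sub => z az; split=> //; have [] := az.
Qed.

End Visits.

(** * Essential intervals and their orbits *)

Record gap_up (R : realType) (f : R -> R) (a b : R) : Prop := GapUp {
  gu0 : 0 <= a; gu1 : b <= 1; gult : a < b; gufl : f a = a; gufr : f b = b;
  gup : forall x, a < x < b -> x < f x }.

Record gap_dn (R : realType) (f : R -> R) (a b : R) : Prop := GapDn {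
  gd0 : 0 <= a; gd1 : b <= 1; gdlt : a < b; gdfl : f a = a; gdfr : f b = b;
  gdn : forall x, a < x < b -> f x < x }.

Lemma gap_reflect (R : realType) (f : R -> R) a b :
  gap_dn f a b <-> gap_up (reflect_map f) (1 - b) (1 - a).
Proof.
split=> -[h0 h1 h2 h3 h4 h5]; split; rewrite /reflect_map ?subKr; try lra.
- by move=> x xab; have := h5 (1 - x) ltac:(lra); lra.
- by move: h4; rewrite /reflect_map !subKr; lra.
- by move: h3; rewrite /reflect_map !subKr; lra.
- move=> x xab; have := h5 (1 - x) ltac:(lra).
  by rewrite /reflect_map !subKr; lra.
Qed.

Section Gaps.
Variables (R : realType) (f : R -> R) (ft : type1_map f).
Implicit Types x y z a b c d : R.

(** Both ends come from [left_fix], the right one after reflection; a fixed point to the right of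
    [x] exists because [f 1 <= 1]. *)
Lemma gap_up_ex x : 0 <= x <= 1 -> x < f x -> (exists p, 0 <= p <= x /\ f p = p) ->
  exists a b, gap_up f a b /\ a < x < b.
Proof.
move=> x01 xfx ex; have [a [ax fa na]] := left_fix ft x01 ex.
have f1 := t1_stab ft (x := 1) ltac:(lra).
have [||||c [cx fc]] := @iter_fixed_between _ _ ft 0 x 1; rewrite /=; try lra.
have [||b' [b'x fb' nb]] := @left_fix _ _ (type1_reflect ft) (1 - x).
- by lra.
- by exists (1 - c); rewrite /reflect_map subKr; split; lra.
move: fb'; rewrite /reflect_map => fb'.
have ax' : a != x by apply/eqP => e; move: fa; rewrite e; lra.
have bx' : 1 - b' != x by apply/eqP => e; move: fb'; rewrite e; lra.
have {}ax' : a < x by rewrite lt_neqAle ax'; lra.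
have {}bx' : x < 1 - b' by rewrite lt_neqAle eq_sym bx'; lra.
have nofix z : a < z < 1 - b' -> f z <> z.
  move=> zab; case: (lerP z x) => zx; first by apply: na; lra.
  have := nb (1 - z); rewrite /reflect_map subKr => /(_ ltac:(lra)) h e.
  by apply: h; lra.
exists a, (1 - b'); split; last by lra.
split; try lra; move=> z zab; rewrite ltNge; apply/negP => fz.
case: (lerP z x) => zx.
- have [||||e [ex' fe]] := @iter_fixed_between _ _ ft 0 z x; rewrite /=; try lra.
  by apply: nofix fe; lra.
- have [||||e [ex' fe]] := @iter_fixed_between _ _ ft 0 x z; rewrite /=; try lra.
  by apply: nofix fe; lra.
Qed.

Lemma gap_essential a b : gap_up f a b \/ gap_dn f a b -> essential_interval f `]a, b[%classic.
Proof.
move=> h.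
have [h0 h1 ab [fa fb nf]] : [/\ 0 <= a, b <= 1, a < b & [/\ f a = a, f b = b &
    forall x, a < x < b -> f x <> x]].
  case: h => -[h0 h1 h2 h3 h4 h5]; split=> //; split=> // x /h5; lra.
exists a, b; split=> //.
- by split=> //; rewrite /unit_itv /= in_itv /=; lra.
- by split=> //; rewrite /unit_itv /= in_itv /=; lra.
- by rewrite -subset0 => x [] /=; rewrite in_itv /= => /nf nx [_ /nx].
Qed.

Lemma essential_gap (I : set R) : essential_interval f I ->
  exists a b, I = `]a, b[%classic /\ (gap_up f a b \/ gap_dn f a b).
Proof.
move=> [a [b [ab [a01 fa] [b01 fb] IE I0]]]; exists a, b; split=> //.
move: a01 b01; rewrite /unit_itv /= !in_itv /= => a01 b01.
have nf x : a < x < b -> f x <> x.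
  move=> xab fx; have : (I `&` Fix f) x.
    split; first by rewrite IE /= in_itv.
    by split=> //; rewrite /unit_itv /= in_itv /=; lra.
  by rewrite I0.
have sgn x y : a < x < b -> a < y < b -> x < f x -> y < f y.
  move=> xab yab xf; rewrite ltNge; apply/negP => yf.
  case: (lerP x y) => xy.
  - have [||||e [exy fe]] := @iter_fixed_between _ _ ft 0 x y; rewrite /=; try lra.
    by apply: nf fe; lra.
  - have [||||e [exy fe]] := @iter_fixed_between _ _ ft 0 y x; rewrite /=; try lra.
    by apply: nf fe; lra.
pose m := (a + b) / 2; have mab : a < m < b by rewrite /m; lra.
have /eqP := nf _ mab; rewrite neq_lt => /orP[fm|fm]; [right|left];
  split=> //; try lra; move=> x xab.
- rewrite lt_neqAle; apply/andP; split; first by apply/eqP; exact: nf.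
  rewrite leNgt; apply/negP => h.
  by have := sgn _ _ xab mab h; lra.
- exact: sgn mab xab fm.
Qed.

(** By [gap_orbit], the orbit of a gap moving right is an interval starting at [a], so only its
    upward extent needs recording. *)
Definition reach a b v : Prop := exists x n, a < x < b /\ v <= iter n f x.

Lemma le_reach a b v w : w <= v -> reach a b v -> reach a b w.
Proof. by move=> wv [x [n [xab h]]]; exists x, n; split=> //; lra. Qed.

(** Otherwise the orbit of [w] would stay in [[w, z]], at a positive distance from the fixed points,
    against [visits_away]. *)
Lemma gap_escape a b w z : gap_up f a b -> a < w < b -> z < b ->
  exists k, z < iter k f w.
Proof.
move=> [a0 b1 ab fa fb up] wab zb.
have w01 : 0 <= w <= 1 by lra.
have [zw|wz] := ltP z w; first by exists 0%N.
have r0 : 0 < Num.min (w - a) (b - z) by rewrite lt_min; lra.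
have [M MP] := visits_away ft r0.
apply: contrapT => nk; have := MP w M.+1 w01.
rewrite /visits (eq_bigr (fun=> 1%N)); last first.
  move=> i _; rewrite asboolT//; split; first exact: iter_stab.
  move=> p p01 fp; have wi := iter_ge ft i w01 (ltW (up _ wab)).
  have iz : iter i f w <= z by rewrite leNgt; apply/negP => h; apply: nk; exists i.
  have [pa|ap] := lerP p a.
    by rewrite ge_min ger0_norm; [apply/orP; left; lra|lra].
  have [bp|pb] := lerP b p.
    by rewrite ge_min distrC ger0_norm; [apply/orP; right; lra|lra].
  by have := up p ltac:(lra); rewrite fp ltxx.
by rewrite sum1_card card_ord ltnn.
Qed.

Lemma gap_reach a b v : gap_up f a b -> v < b -> reach a b v.
Proof.
move=> g vb; have ab := gult g.
have [||k hk] := @gap_escape a b ((a + b) / 2) v g; [lra|exact: vb|].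
by exists ((a + b) / 2), k; split; lra.
Qed.

Lemma gap_orbit a b y : gap_up f a b -> Orb f `]a, b[%classic y <-> a < y /\ reach a b y.
Proof.
move=> [a0 b1 ab fa fb up]; split.
  move=> [n _ [x /=]]; rewrite in_itv /= => xab yE.
  have := iter_ge ft n (x := x) ltac:(lra) (ltW (up _ xab)).
  by rewrite yE => xy; split; [lra|exists x, n; rewrite yE].
move=> [ay [x [n [xab yx]]]].
have [||||c [cax cE]] := @iter_IVT _ _ ft n a x y; rewrite ?(iter_fix n fa); try lra.
exists n => //; exists c => //=; rewrite in_itv /=.
suff : c != a by move=> ca; apply/andP; split; [rewrite lt_neqAle eq_sym ca|]; lra.
by apply/eqP => ca; move: cE; rewrite ca iter_fix//; lra.
Qed.

Lemma reach_iter a b v n : gap_up f a b -> a < v -> reach a b v -> reach a b (iter n f v).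
Proof.
move=> g av rv; have [m _ [x xab xv]] : Orb f `]a, b[%classic v by apply/gap_orbit.
move: xab; rewrite /= in_itv /= => xab.
by exists x, (n + m)%N; rewrite iterD xv.
Qed.

(** An orbit that has entered the gap past [a'] climbs it by [gap_escape], coming as close to [b']
    as required. *)
Lemma reach_up a b a' b' v z : gap_up f a' b' ->
  a' < v -> reach a b v -> z < b' -> reach a b z.
Proof.
move=> g' av [x [n [xab h]]] zb.
have [zx|xz] := lerP z (iter n f x); first by exists x, n.
have [||k hk] := @gap_escape a' b' (iter n f x) z g' => //; first by lra.
by exists x, (k + n)%N; rewrite iterD; split=> //; exact: ltW.
Qed.

Lemma gap_link_up a b a' b' v : gap_up f a b -> gap_up f a' b' ->
  a <= a' -> a' < v -> reach a b v -> `]a', b'[ `<=` Orb f `]a, b[%classic.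
Proof.
move=> g g' aa av rv z /=; rewrite in_itv /= => zab; apply/(gap_orbit _ g); split.
  by lra.
by apply: reach_up g' av rv _; lra.
Qed.

Lemma gap_link_dn a b c d : gap_up f a b ->
  a <= c -> reach a b d -> `]c, d[ `<=` Orb f `]a, b[%classic.
Proof.
move=> g ac rd z /=; rewrite in_itv /= => zcd; apply/(gap_orbit _ g); split.
  by lra.
by apply: le_reach rd; lra.
Qed.

(* An orbit set approaching the repelling end [d] of a gap contains it: the
   maximum of [f] over the part far from [d] would otherwise bound the orbits
   away from [d]. *)
Lemma reach_dichotomy a b c d : gap_up f a b -> gap_dn f c d ->
  reach a b d \/ exists r, 0 < r /\ forall v, reach a b v -> v <= d - r.
Proof.
move=> g [c0 d1 cd fc fd dn]; have [rd|nrd] := pselect (reach a b d); first by left.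
right; have [a0 b1 ab fa fb up] := g.
have bc : b <= c.
  rewrite leNgt; apply/negP => cb.
  have [db|bd] := ltP d b; first by apply: nrd; exact: gap_reach.
  have [ac|ca] := lerP c a; last by have := up c ltac:(lra); lra.
  have := dn ((a + b) / 2) ltac:(lra); have := up ((a + b) / 2) ltac:(lra); lra.
pose t0 := (c + d) / 2; have t0E : t0 = (c + d) / 2 by [].
have [rt0|nrt0] := pselect (reach a b t0); last first.
  exists (d - t0); split; first by lra.
  move=> v rv; have [|h] := lerP v (d - (d - t0)) => //.
  by case: nrt0; apply: le_reach rv; lra.
have [||y] := @EVT_max _ f a t0; first by lra.
  by apply: (@iter_cont _ _ ft 1) => //; lra.
rewrite in_itv /= => yat ymax.
have fyd : f y < d.
  have [ya|ay] := lerP y a; first by rewrite (_ : y = a) ?fa; lra.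
  rewrite ltNge; apply/negP => dfy; apply: nrd; apply: le_reach dfy _.
  by apply: (@reach_iter a b y 1) => //; apply: le_reach rt0; lra.
have [t [t0t fyt td]] : exists t, [/\ t0 <= t, f y <= t & t < d].
  exists (Num.max t0 (f y)); rewrite !le_max !lexx orbT gt_max fyd; split=> //.
  by lra.
exists (d - t); split; first by lra.
move=> v [x [n [xab vx]]].
suff : a <= iter n f x <= t by lra.
have xt : a <= x <= t by lra.
(* Up to [t0] the values are at most [f y <= t]; between [t0] and [t] points move left. *)
have inv w : a <= w <= t -> f w <= t.
  move=> wt; have [wt0|tw] := lerP w t0.
    by apply: le_trans fyt; apply: ymax; rewrite in_itv /=; lra.
  by have := dn w ltac:(lra); lra.
suff h m : iter m f x <= t.
  by rewrite h andbT; have := iter_ge ft n (x := x) ltac:(lra) (ltW (up _ xab)); lra.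
elim: m => [|m IH]; first by rewrite /=; lra.
rewrite iterS; apply: inv; rewrite IH andbT.
by have := iter_ge ft m (x := x) ltac:(lra) (ltW (up _ xab)); lra.
Qed.

End Gaps.

(** * From chains to horseshoes *)

Definition gap (R : realType) (f : R -> R) (u : bool) (a b : R) : Prop :=
  if u then gap_up f a b else gap_dn f a b.

(* The endpoint from which the orbits in the gap move away. *)
Definition source (R : realType) (u : bool) (a b : R) : R := if u then a else b.

Definition source_itv (R : realType) (u : bool) (a b d : R) : set R :=
  if u then `[a, a + d]%classic else `[b - d, b]%classic.

Lemma gap_reflectb (R : realType) (f : R -> R) u a b :
  gap f u a b -> gap (reflect_map f) (~~ u) (1 - b) (1 - a).
Proof.
case: u => /= [g|/gap_reflect//]; apply/gap_reflect.
case: g => h0 h1 h2 h3 h4 h5; split; rewrite /reflect_map ?subKr; try lra.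
all: rewrite /reflect_map ?subKr ?h3 ?h4 //.
by move=> x xab; have := h5 x; rewrite !subKr; lra.
Qed.

Lemma Orb_reflect (R : realType) (f : R -> R) a b y :
  Orb f `]a, b[%classic y -> Orb (reflect_map f) `]1 - b, 1 - a[%classic (1 - y).
Proof.
move=> [n _ [x /=]]; rewrite in_itv /= => xab <-; exists n => //.
by exists (1 - x); rewrite /= ?in_itv /=; [lra|rewrite iter_reflect subKr].
Qed.

Lemma Orb_trans (R : realType) (f : R -> R) (A B C : set R) :
  A `<=` Orb f B -> B `<=` Orb f C -> A `<=` Orb f C.
Proof.
move=> AB BC x /AB[n _ [y /BC[m _ [z Cz <-]] <-]].
by exists (n + m)%N => //; exists z => //; rewrite iterD.
Qed.

Section SourceCover.
Variables (R : realType) (f : R -> R) (ft : type1_map f).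
Implicit Types x y z a b c d v : R.

Lemma gap_up_inj a b b' : gap_up f a b -> gap_up f a b' -> b = b'.
Proof.
move=> g g'; apply/eqP; rewrite eq_le; apply/andP; split; rewrite leNgt; apply/negP => h.
- by have := gup g (x := b'); rewrite (gufr g'); have := gult g'; lra.
- by have := gup g' (x := b); rewrite (gufr g); have := gult g; lra.
Qed.

(** Since [a] is fixed while [a + d] climbs past any point of the gap, an iterate of the short
    interval [[a, a + d]] contains the point [w] that reaches [v]; a further iterate then covers
    [[a, v]]. *)
Lemma reach_source a b v d : gap_up f a b -> 0 < d -> reach f a b v ->
  exists n, forall y, a <= y <= v ->
    exists x, a <= x <= a + d /\ iter n f x = y.
Proof.
move=> g d0 [w [m [wab h]]]; have [a0 b1 ab fa fb up] := g.
have [x [k [xad kx wx]]] : exists x k, [/\ a <= x <= a + d, x <= 1 & iter k f x = w].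
  have [wd|dw] := lerP w (a + d); first by exists w, 0%N; split=> //; lra.
  have [||k hk] := @gap_escape _ _ ft a b (a + d) w g; try lra.
  have [||||c [cx cE]] := @iter_IVT _ _ ft k a (a + d) w; rewrite ?(iter_fix k fa); try lra.
  by exists c, k; split=> //; lra.
exists (m + k)%N => y yv.
have [||||c [cx' cE]] := @iter_IVT _ _ ft (m + k) a x y;
  rewrite ?(iter_fix _ fa) ?(iterD m k f x) ?wx; try lra.
by exists c; split=> //; lra.
Qed.

(** The delicate case is a second gap moving left, where the source [b'] itself must be covered: the
    orbit of the first gap comes arbitrarily close to [b'], so [reach_dichotomy] shows that it
    reaches [b']. *)
Lemma source_cover_up u a b a' b' : gap_up f a b -> gap f u a' b' ->
  `]a', b'[ `<=` Orb f `]a, b[%classic -> (a', b') <> (a, b) ->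
  a < source u a' b' /\ forall d d', 0 < d -> 0 < d' < b' - a' ->
    exists n, source_itv u a' b' d' `<=` iter n f @` source_itv true a b d.
Proof.
move=> g g' sub neq.
have ab' : a' < b' by case: u g' => /= [/gult|/gdlt].
have aa' : a <= a'.
  rewrite leNgt; apply/negP => h.
  have : `]a', b'[%classic (Num.min ((a' + b') / 2) ((a' + a) / 2)).
    by rewrite /= in_itv /= lt_min gt_min; lra.
  move=> /sub /(gap_orbit ft _ g)[]; rewrite lt_min; lra.
have cover v d : a <= v -> 0 < d -> reach f a b v ->
      exists n, `[a, v]%classic `<=` iter n f @` source_itv true a b d.
  move=> av d0 rv; have [n nP] := reach_source g d0 rv; exists n => y /=.
  rewrite in_itv /= => /nP[x [xad xy]]; exists x => //=; by rewrite in_itv.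
case: u g' => /= g'.
- split.
    rewrite lt_neqAle aa' andbT; apply/eqP => aE; apply: neq; rewrite -aE.
    by congr pair; apply: (@gap_up_inj a) => //; rewrite aE.
  move=> d d' d0 d'0; have [|//||n nP] := cover (a' + d') d; first by lra.
    have /sub/(gap_orbit ft _ g)[//] : `]a', b'[%classic (a' + d').
    by rewrite /= in_itv /=; lra.
  exists n => y; rewrite /= in_itv /= => yd; apply: nP; rewrite /= in_itv /=; lra.
- have rb : reach f a b b'.
    have [//|[r [r0 rP]]] := reach_dichotomy ft g g'.
    have /sub/(gap_orbit ft _ g)[_ /rP] : `]a', b'[%classic (Num.max ((a' + b') / 2) (b' - r / 2)).
      by rewrite /= in_itv /= lt_max gt_max; lra.
    by rewrite ge_max; lra.
  split; first by lra.
  move=> d d' d0 d'0; have [|//|//|n nP] := cover b' d; first by lra.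
  exists n => y; rewrite /= in_itv /= => yd; apply: nP; rewrite /= in_itv /=; lra.
Qed.

Lemma source_itv_expand u a b d : gap f u a b -> 0 < d < b - a ->
  source_itv u a b d `<=` f @` source_itv u a b d.
Proof.
case: u => /= -[a0 b1 ab fa fb mono] d0 y /=; rewrite in_itv /= => yd.
- have [||||c [cx cE]] := @iter_IVT _ _ ft 1 a (a + d) y; rewrite /= ?fa; try lra.
    by have := mono (a + d); lra.
  by exists c => //; rewrite /= in_itv.
- have [||||c [cx cE]] := @iter_IVT _ _ ft 1 (b - d) b y; rewrite /= ?fb; try lra.
    by have := mono (b - d); lra.
  by exists c => //; rewrite /= in_itv.
Qed.

End SourceCover.

Section Chains.
Variables (R : realType) (f : R -> R) (ft : type1_map f).
Implicit Types x y z a b c d v : R.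

Lemma source_itv_reflect u a b d y : source_itv u a b d y <->
  source_itv (~~ u) (1 - b) (1 - a) d (1 - y).
Proof. by case: u => /=; rewrite !in_itv /=; split; lra. Qed.

Lemma source_cover u u' a b a' b' : gap f u a b -> gap f u' a' b' ->
  `]a', b'[ `<=` Orb f `]a, b[%classic -> (a', b') <> (a, b) ->
  source u' a' b' <> source u a b /\ forall d d', 0 < d -> 0 < d' < b' - a' ->
    exists n, source_itv u' a' b' d' `<=` iter n f @` source_itv u a b d.
Proof.
case: u => g g' sub neq.
  have [h1 h2] := source_cover_up ft g g' sub neq; split=> //.
  by move: h1 => /=; lra.
have [||h1 h2] := source_cover_up (type1_reflect ft) (gap_reflectb g) (gap_reflectb g').
- move=> y; rewrite /= in_itv /= => yab.
  rewrite -(subKr 1 y); apply: Orb_reflect; apply: sub.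
  by rewrite /= in_itv /=; lra.
- move=> [e1 e2]; apply: neq; congr pair; lra.
split; first by move: h1; case: u' {g' h2} => /=; lra.
move=> d d' d0 d'0; have [//||n nP] := h2 d d'; first by move: d'0; clear; lra.
exists n => y /source_itv_reflect /nP[x xs]; rewrite iter_reflect => xy.
by exists (1 - x); [apply/source_itv_reflect; rewrite subKr|lra].
Qed.

Lemma fin_pos_lb (T : finType) (g : T -> R) : (forall i, 0 < g i) ->
  exists d, 0 < d /\ forall i, d <= g i.
Proof.
move=> g0; exists (\big[Num.min/1]_i g i); split.
  by elim/big_ind: _ => // x y x0 y0; rewrite lt_min x0.
by move=> i; rewrite (bigD1 i)//= ge_min lexx.
Qed.

Lemma source_itv_near u a b d y : source_itv u a b d y -> `|y - source u a b| <= d.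
Proof. by case: u => /=; rewrite in_itv /= ler_distl; lra. Qed.

Lemma source_itv_iter u a b d m n : gap f u a b -> 0 < d < b - a ->
  iter n f @` source_itv u a b d `<=` iter (n + m) f @` source_itv u a b d.
Proof.
move=> g d0; elim: m => [|m IH]; first by rewrite addn0.
move=> y /IH[x xs <-]; have [z zs zx] := source_itv_expand ft g d0 xs.
by exists z => //; rewrite addnS iterSr zx.
Qed.

Lemma nonfixed_not_recurrent x N : 0 <= x <= 1 -> f x <> x -> (0 < N)%N ->
  ~ recurrent (iter N f) x.
Proof.
move=> x01 fx N0 rec; have [e [e0 eP]] := wandering ft x01 fx.
have [n [n1]] := rec e e0; rewrite -iterM.
have : (0 < n * N)%N by rewrite muln_gt0 n1.
case: (n * N)%N => // k _; rewrite ltNge => /negP; apply.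
by apply: eP => //; rewrite subrr normr0.
Qed.

Lemma chain_sub_Orb l (I : 'I_l -> set R) : chain f I ->
  forall i j : 'I_l, (i < j)%N -> I j `<=` Orb f (I i).
Proof.
move=> [_ _ _ link] i [j jl] /=; elim: j jl => // j IH jl; rewrite ltnS leq_eqVlt.
move=> /orP[/eqP ij|ij]; first by apply: link; rewrite /= ij.
by apply: Orb_trans (IH (ltnW jl) ij); apply: link.
Qed.

(** The members of the horseshoe are equally short intervals at the sources, which are pairwise
    distinct by [source_cover]. *)
Lemma chain_itv_horseshoe l : chain_lengths f l -> itv_horseshoe_orders f l.
Proof.
move=> [I cI]; have sub := chain_sub_Orb cI; case: cI => l0 ess inj _.
have gaps i : exists t : bool * (R * R), I i = `]t.2.1, t.2.2[%classic /\ gap f t.1 t.2.1 t.2.2.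
  have [a [b [IE [g|g]]]] := essential_gap ft (ess i).
  - by exists (true, (a, b)).
  - by exists (false, (a, b)).
have [t tP] := choice gaps.
pose src i := source (t i).1 (t i).2.1 (t i).2.2.
have neqt i j : i != j -> (t i).2 <> (t j).2.
  move=> /eqP ij e; apply: ij; apply: inj.
  by rewrite (tP i).1 (tP j).1 e.
have cov (i j : 'I_l) : (i < j)%N -> src j <> src i /\
    forall d d', 0 < d -> 0 < d' < (t j).2.2 - (t j).2.1 ->
    exists n, source_itv (t j).1 (t j).2.1 (t j).2.2 d' `<=`
      iter n f @` source_itv (t i).1 (t i).2.1 (t i).2.2 d.
  move=> ij; apply: source_cover (tP i).2 (tP j).2 _ _.
    by rewrite -(tP i).1 -(tP j).1; exact: sub.
  rewrite -!surjective_pairing; apply: neqt.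
  by apply/eqP => e; move: ij; rewrite e ltnn.
have src_neq i j : i != j -> src i != src j.
  move=> ij; apply/eqP; have : (i < j)%N || (j < i)%N by rewrite -neq_ltn.
  by move=> /orP[] /cov[h _] e; apply: h.
have len i : 0 < (t i).2.2 - (t i).2.1.
  by have := (tP i).2; case: (t i).1 => /= [/gult|/gdlt]; lra.
have [d1 [d10 d1P]] := fin_pos_lb len.
have [|d2 [d20 d2P]] := @fin_pos_lb ('I_l * 'I_l)%type
  (fun p => if p.1 == p.2 then 1 else `|src p.1 - src p.2|).
  by move=> [i j] /=; case: eqVneq => // /src_neq; rewrite normr_gt0 subr_eq0.
(* Here [d1] bounds the lengths of the gaps from below and [d2] the distances between sources; two
   intervals of length at most [d2 / 3] cannot bridge a distance [d2]. *)
pose d := Num.min (d1 / 2) (d2 / 3).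
have d0 : 0 < d by rewrite lt_min; lra.
have dd1 : d < d1 by rewrite gt_min; lra.
have dd2 : d <= d2 / 3 by rewrite ge_min lexx orbT.
have dlen i : 0 < d < (t i).2.2 - (t i).2.1 by have := d1P i; lra.
pose A i := source_itv (t i).1 (t i).2.1 (t i).2.2 d.
have covn (p : 'I_l * 'I_l) : exists n, (p.1 < p.2)%N -> A p.2 `<=` iter n f @` A p.1.
  case: (boolP (p.1 < p.2)%N) => [/cov[_ /(_ d d d0 (dlen _))][n nP]|_]; first by exists n.
  by exists 0%N.
have [n nP] := choice covn.
(* A common covering time: coverings persist under further iteration because the source intervals
   expand. The successor makes it positive. *)
pose N := (\max_p n p).+1.
have subI i : A i `<=` unit_itv R /\ closed_interval (A i).
  have [a0 b1] : 0 <= (t i).2.1 /\ (t i).2.2 <= 1.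
    by have := (tP i).2; case: (t i).1 => /= -[].
  have := dlen i; rewrite /A /unit_itv; case: (t i).1 => /= dl; split.
  - by move=> y; rewrite /= !in_itv /=; lra.
  - by exists (t i).2.1, ((t i).2.1 + d); split=> //; lra.
  - by move=> y; rewrite /= !in_itv /=; lra.
  - by exists ((t i).2.2 - d), (t i).2.2; split=> //; lra.
exists N; split=> //; exists A; split; last by move=> i; exact: (subI i).2.
split=> //.
- move=> i; split; first exact: (subI i).1.
  by have [a [b [_ ->]]] := (subI i).2; exact: segment_compact.
- move=> i j _ _ [y [/source_itv_near yi /source_itv_near yj]].
  apply/eqP/negPn/negP => ij; have := d2P (i, j); rewrite /= (negbTE ij) -/(src i) -/(src j) in yi yj *.
  rewrite distrC in yi; have := ler_normD (src i - y) (y - src j).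
  by rewrite addrA subrK; lra.
- move=> i _; have := dlen i; have := (tP i).2; rewrite /A.
  case: (t i).1 => /= g dl; case: (g) => a0 b1 ab fa fb mono.
  + exists ((t i).2.1 + d); first by rewrite /= in_itv /=; lra.
    apply: nonfixed_not_recurrent => //; first by lra.
    by have := mono ((t i).2.1 + d); lra.
  + exists ((t i).2.2 - d); first by rewrite /= in_itv /=; lra.
    apply: nonfixed_not_recurrent => //; first by lra.
    by have := mono ((t i).2.2 - d); lra.
- move=> i j; rewrite leq_eqVlt => /orP[/eqP/val_inj <-|ij].
    have := @source_itv_iter _ _ _ _ N 0 (tP i).2 (dlen i).
    by rewrite add0n => h y Ay; apply: h; exists y.
  apply: subset_trans (nP (i, j) ij) _ => /=.
  have nN : (n (i, j) <= N)%N by apply: leqW; exact: leq_bigmax.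
  by rewrite -(subnKC nN); exact: source_itv_iter (tP i).2 (dlen i).
Qed.

End Chains.

(** * From horseshoes to entropy *)

Section Entropy.
Variables (R : realType) (f : R -> R).
Implicit Types x y z e : R.

Lemma nat_sup_ub (A : set nat) k : A k -> ((k%:R)%:E <= nat_sup R A)%E.
Proof.
move=> Ak; rewrite /nat_sup; case: eqP => [A0|_]; first by rewrite A0 in Ak.
by apply: ereal_sup_ubound; exists k.
Qed.

Lemma nat_sup_leP (A : set nat) (v : \bar R) : (0 <= v)%E ->
  (forall k, A k -> ((k%:R)%:E <= v)%E) -> (nat_sup R A <= v)%E.
Proof.
move=> v0 Av; rewrite /nat_sup; case: eqP => // _.
by apply: ge_ereal_sup => _ [k Ak <-]; exact: Av.
Qed.

Lemma nat_sup_ge0 (A : set nat) : (0 <= nat_sup R A)%E.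
Proof.
rewrite /nat_sup; case: eqP => // /eqP/set0P[k Ak].
apply: (@le_trans _ _ (k%:R)%:E); first by rewrite lee_fin.
by apply: ereal_sup_ubound; exists k.
Qed.

Lemma nat_sup_natbar (A : set nat) : natbar R (nat_sup R A).
Proof.
have [[N AN]|nb] := pselect (exists N, forall k, A k -> (k <= N)%N).
  right; elim: N AN => [|N IH] AN.
    exists 0%N; apply/eqP; rewrite eq_le nat_sup_ge0 andbT.
    by apply: nat_sup_leP => // k /AN; rewrite leqn0 => /eqP ->.
  have [AN1|nAN1] := pselect (A N.+1).
    exists N.+1; apply/eqP; rewrite eq_le nat_sup_ub// andbT.
    by apply: nat_sup_leP => [|k /AN kN]; rewrite lee_fin ?ler_nat.
  apply: IH => k Ak; rewrite -ltnS ltn_neqAle AN// andbT.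
  by apply/eqP => kE; rewrite kE in Ak.
left; apply/eqyP => r r0.
have [k [Ak rk]] : exists k, A k /\ (Num.bound r < k)%N.
  apply: contrapT => h; apply: nb; exists (Num.bound r) => k Ak.
  by rewrite leqNgt; apply/negP => hk; apply: h; exists k.
apply: le_trans (nat_sup_ub Ak); rewrite lee_fin.
apply: ltW; apply: lt_le_trans (archi_boundP (ltW r0)) _.
by rewrite ler_nat ltnW.
Qed.

Lemma sep_ge (T : finType) (p : T -> R) n e : 0 <= e ->
  (forall i, 0 <= p i <= 1) ->
  (forall i j, i != j -> exists2 t, (t < n)%N & e < `|iter t f (p i) - iter t f (p j)|) ->
  ((#|T|%:R)%:E <= sep n e f)%E.
Proof.
move=> e0 p01 psep; apply: nat_sup_ub.
have pinj : injective p.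
  move=> i j pij; apply/eqP/negPn/negP => /psep[t _].
  by rewrite pij subrr normr0 ltNge e0.
exists ((p \o enum_val) @` [set: 'I_#|T|]); split; last first.
  by apply: inj_card_eq => i j _ _ /pinj /enum_val_inj.
split; first by move=> _ [i _ <-]; rewrite /unit_itv /= in_itv /=.
move=> _ _ [i _ <-] [j _ <-] /= ij.
have /psep[t tn et] : enum_val i != enum_val j by apply/eqP => h; apply: ij; rewrite h.
by apply/bigmax_gtP; right; exists (Ordinal tn).
Qed.

(** The constant [c] disappears in the limit, because [ln (c * m)] and [ln m] are asymptotically
    equal. *)
Lemma sep_growth_ge (l c : nat) e : (0 < c)%N ->
  (forall m, (0 < m)%N -> (((m ^ l)%N%:R)%:E <= sep (c * m) e f)%E) ->
  ((l%:R)%:E <= sep_growth f e)%E.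
Proof.
move=> c0 H; apply: le_ereal_inf_tmp => _ [V [N _ NV] <-].
apply/lee_addgt0Pr => d d0.
rewrite -leeBlDr//.
pose B := (l%:R * ln c%:R) / d : R.
pose m := maxn N (maxn 2 (Num.bound (expR B))).
have m2 : (2 <= m)%N by rewrite /m; lia.
have m0 : (0 < m)%N by lia.
have lnm : B <= ln m%:R.
  rewrite -[B]expRK ler_ln ?posrE ?expR_gt0 ?ltr0n//.
  apply: ltW; apply: lt_le_trans (archi_boundP (expR_ge0 _)) _.
  by rewrite ler_nat /m; lia.
have lnm0 : 0 < ln m%:R :> R by rewrite ln_gt0// ltr1n.
have lnc0 : 0 <= ln c%:R :> R by rewrite ln_ge0// ler1n.
have lncm : ln (c * m)%:R = ln c%:R + ln m%:R :> R.
  by rewrite natrM lnM// posrE ltr0n.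
apply: (@le_trans _ _ (lne (((m ^ l)%N%:R)%:E) * ((ln (c * m)%:R)^-1)%:E)%E).
  rewrite lne_EFin ?ltr0n ?expn_gt0 ?m0// natrX lnXn ?ltr0n// lee_fin.
  rewrite ler_pdivlMr lncm; last by lra.
  move: lnm; rewrite /B ler_pdivrMr// -mulr_natl => h.
  have : 0 <= d * ln c%:R by apply: mulr_ge0 => //; lra.
  by rewrite mulrBl !mulrDr; lra.
apply: (@le_trans _ _ (lne (sep (c * m) e f) * ((ln (c * m)%:R)^-1)%:E)%E).
  apply: lee_wpmul2r; first by rewrite lee_fin invr_ge0; lra.
  by apply: le_lne; exact: H.
apply: ereal_sup_ubound; exists (c * m)%N => //; apply: NV => /=.
by rewrite /m; nia.
Qed.

Lemma hpol_ge (v : \bar R) e0 : 0 < e0 ->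
  (forall e, 0 < e -> e < e0 -> (v <= sep_growth f e)%E) -> (v <= hpol f)%E.
Proof.
move=> e00 H; apply: lime_ge; first exact: cvg_sep_growth.
near=> e; exact: H.
Unshelve. all: by end_near. Qed.

Lemma hpol_le (v : \bar R) :
  (forall e, 0 < e -> (sep_growth f e <= v)%E) -> (hpol f <= v)%E.
Proof.
move=> H; apply: lime_le; first exact: cvg_sep_growth.
near=> e; exact: H.
Unshelve. all: by end_near. Qed.

Lemma hpol_ge0 : (0 <= hpol f)%E.
Proof.
apply: (@hpol_ge _ 1) => // e e0 _; rewrite -[0%E]/(0%N%:R%:E).
apply: (@sep_growth_ge 0 1) => // m _; rewrite expn0.
have := @sep_ge 'I_1 (fun=> 0) (1 * m) e (ltW e0); rewrite card_ord; apply.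
  by move=> _; rewrite lexx ler01.
by move=> i j; rewrite (ord1 i) (ord1 j).
Qed.

(** Each point has a neighbourhood that either misses [A] or stays at a positive distance from [B];
    [itv01_local] makes the distance uniform. *)
Lemma disjoint_compact_dist (A B : set R) : compact A -> compact B ->
  A `<=` unit_itv R -> A `&` B = set0 ->
  exists e, 0 < e /\ forall x y, A x -> B y -> e <= `|x - y|.
Proof.
move=> /(compact_closed (@Rhausdorff R)) cA /(compact_closed (@Rhausdorff R)) cB A01 AB.
have ex C z : closed C -> ~ C z -> exists d : R, 0 < d /\ forall y, `|y - z| < d -> ~ C y.
  move=> cC nCz; have : nbhs z (~` C) by apply: open_nbhs_nbhs; split => //; exact: closed_openC.
  move=> [d /= d0 dP]; exists d; split=> // y yz; apply: dP => /=.
  by rewrite distrC.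
pose P (J : set R) := exists e, 0 < e /\ forall x y, A x -> J x -> B y -> e <= `|x - y|.
have [||z z01|e [e0 eP]] := @itv01_local _ P.
- by move=> C D CD [e [e0 eP]]; exists e; split=> // x y Ax /CD; exact: eP.
- move=> C D [e [e0 eP]] [e' [e'0 e'P]]; exists (Num.min e e'); split.
    by rewrite lt_min e0.
  by move=> x y Ax CDx By; rewrite ge_min; case: CDx => h; apply/orP; [left; exact: eP|right; exact: e'P].
- have [Bz|nBz] := pselect (B z).
    have nAz : ~ A z by move=> Az; have : (A `&` B) z by []; rewrite AB.
    have [d [d0 dP]] := ex _ _ cA nAz; exists d; split=> //; exists 1; split=> //.
    by move=> x y Ax /dP.
  have [d [d0 dP]] := ex _ _ cB nBz; exists (d / 2); split; first by lra.
  exists (d / 2); split; first by lra.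
  move=> x y Ax /= xz By; rewrite leNgt; apply/negP => xy.
  apply: (dP y) By; move: xz xy; rewrite !ltr_distl; lra.
- exists e; split=> // x y Ax By; apply: eP => //.
  by have := A01 _ Ax; rewrite /unit_itv /= in_itv.
Qed.

End Entropy.

(** * Itineraries in a horseshoe *)

Section Horseshoe.
Variables (R : realType) (g : R -> R) (l : nat) (A : 'I_l.+1 -> set R).
Hypothesis cover : forall i j : 'I_l.+1, (i <= j)%N -> A j `<=` g @` A i.

(** The point is found backwards from [x], taking one preimage per step by the covering relation. *)
Lemma horseshoe_itinerary (w : nat -> 'I_l.+1) K x :
  (forall s t, (s <= t <= K)%N -> (w s <= w t)%N) -> A (w K) x ->
  exists p, iter K g p = x /\ forall t, (t <= K)%N -> A (w t) (iter t g p).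
Proof.
elim: K w x => [|K IH] w x wm Ax.
  by exists x; split=> // t; rewrite leqn0 => /eqP ->.
have [||p [pK pP]] := IH (w \o succn) x.
- by move=> s t /andP[st tK]; apply: wm; rewrite !ltnS st.
- exact: Ax.
have /(cover (i := w 0%N))[|q Aq qp] := pP 0%N isT; first by apply: wm; lia.
exists q; rewrite iterSr qp; split=> // -[|t] tK //.
by rewrite iterSr qp; exact: pP.
Qed.

(* The itinerary passing from [A i] to [A i.+1] at time [i * m + k i]. *)
Definition itinerary m (k : {ffun 'I_l.+1 -> 'I_m}) (t : nat) : 'I_l.+1 :=
  inord (minn l (t %/ m + (k (inord (t %/ m)) <= t %% m)))%N.

(** The last coordinate of [k] has no further set to move to; it encodes when the nonrecurrent point
    is hit. *)
Definition final_time m (k : {ffun 'I_l.+1 -> 'I_m}) : nat :=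
  (l * m + k ord_max)%N.

Lemma itineraryE m (k : {ffun 'I_l.+1 -> 'I_m}) t :
  itinerary k t = minn l (t %/ m + (k (inord (t %/ m)) <= t %% m))%N :> nat.
Proof. by rewrite inordK// ltnS geq_minl. Qed.

Lemma itinerary_mono m (k : {ffun 'I_l.+1 -> 'I_m}) s t : (s <= t)%N ->
  (itinerary k s <= itinerary k t)%N.
Proof.
move=> st; rewrite !itineraryE leq_min geq_minl /= geq_min; apply/orP; right.
have := leq_div2r m st; rewrite leq_eqVlt => /orP[/eqP e|lt].
  rewrite -e leq_add2l.
  have : (s %% m <= t %% m)%N.
    by move: st; rewrite {1}(divn_eq s m) {1}(divn_eq t m) -e leq_add2l.
  by case: (boolP (_ <= s %% m)%N) => // h2 h1; rewrite (leq_trans h2 h1).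
by case: (_ <= s %% m)%N; case: (_ <= t %% m)%N; lia.
Qed.

Lemma itinerary_final m (k : {ffun 'I_l.+1 -> 'I_m}) :
  itinerary k (final_time k) = ord_max.
Proof.
have m0 : (0 < m)%N by case: m k => // k; case: (k ord0).
apply: val_inj; rewrite /= itineraryE /final_time divnMDl//.
by rewrite divn_small// addn0; apply/minn_idPl; exact: leq_addr.
Qed.

(** At this time the first itinerary has just moved on to [i + 1], while the second is still at
    [i]. *)
Lemma itinerary_neq m (k k' : {ffun 'I_l.+1 -> 'I_m}) (i : 'I_l.+1) :
  (k i < k' i)%N -> (i < l)%N ->
  itinerary k (i * m + k i)%N != itinerary k' (i * m + k i)%N.
Proof.
move=> kk il; have m0 : (0 < m)%N by case: m k k' kk => // k; case: (k ord0).
rewrite -val_eqE /= !itineraryE divnMDl// divn_small// addn0 modnMDl modn_small//.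
by rewrite inord_val leqnn leqNgt kk /= addn0; lia.
Qed.

End Horseshoe.

(** Every [k] yields a point that follows its itinerary and hits [x] at its final time. Different
    final times separate two points because [x] does not return close to itself; with equal final
    times the itineraries differ at some moment, and the members of the horseshoe are at a positive
    distance. *)
Lemma hpol_ge_horseshoe (R : realType) (f : R -> R) l :
  horseshoe_orders f l -> ((l%:R)%:E <= hpol f)%E.
Proof.
move=> [n [n0 [A [l0 Ac Atriv Anr cov]]]].
case: l => // l in A l0 Ac Atriv Anr cov *.
have [x Ax nrx] := Anr ord_max erefl.
have [e1 [e10 e1P]] : exists e1 : R, 0 < e1 /\ forall k, e1 <= `|iter k.+1 (iter n f) x - x|.
  apply: contrapT => h; apply: nrx => e e0; apply: contrapT => h'; apply: h.
  exists e; split=> // k; rewrite leNgt; apply/negP => ke; apply: h'.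
  by exists k.+1.
have distA (p : 'I_l.+1 * 'I_l.+1) : exists e : R, 0 < e /\
    (p.1 != p.2 -> forall y z, A p.1 y -> A p.2 z -> e <= `|y - z|).
  have [->|pp] := eqVneq p.1 p.2; first by exists 1.
  have [||||e [e0 eP]] := @disjoint_compact_dist _ (A p.1) (A p.2).
  - exact: (Ac _).2.
  - exact: (Ac _).2.
  - exact: (Ac _).1.
  - apply/eqP/negPn/negP => /set0P ne; move/eqP: pp; apply.
    by apply: Atriv => //.
  - by exists e.
have [E EP] := choice distA.
have [e2 [e20 e2P]] := fin_pos_lb (fun p => (EP p).1).
apply: (@hpol_ge _ _ _ (Num.min e1 e2)); first by rewrite lt_min e10.
move=> e e0; rewrite lt_min => /andP[ee1 ee2].
apply: (@sep_growth_ge _ _ _ (n * l.+1)); first by rewrite muln_gt0 n0.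
move=> m m0.
have real (k : {ffun 'I_l.+1 -> 'I_m}) : exists p, iter (final_time k) (iter n f) p = x /\
    forall t, (t <= final_time k)%N -> A (itinerary k t) (iter t (iter n f) p).
  apply: horseshoe_itinerary cov _ _ _ _ _; last by rewrite itinerary_final.
  by move=> s t /andP[st _]; exact: itinerary_mono.
have [p pP] := choice real.
rewrite -[X in (X ^ _)%N](card_ord m) -[X in (_ ^ X)%N](card_ord l.+1) -card_ffun.
have p01 k : 0 <= p k <= 1.
  have := (pP k).2 0%N (leq0n _) => /(Ac _).1; by rewrite /unit_itv /= in_itv.
apply: (sep_ge (p := p)) => //; first exact: ltW.
have fin_lt (k : {ffun 'I_l.+1 -> 'I_m}) : (final_time k < l.+1 * m)%N.
  by have := ltn_ord (k ord_max); rewrite /final_time mulSn; lia.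
suff H (k k' : {ffun 'I_l.+1 -> 'I_m}) (i : 'I_l.+1) : (k i < k' i)%N -> exists2 t, (t < l.+1 * m)%N &
    e < `|iter t (iter n f) (p k) - iter t (iter n f) (p k')|.
  move=> k k' kk.
  have [i ki] : exists i, k i != k' i.
    apply: contrapT => h; move/eqP: kk; apply; apply/ffunP => i.
    by apply/eqP/negPn/negP => ki; apply: h; exists i.
  have [t tm et] : exists2 t, (t < l.+1 * m)%N &
      e < `|iter t (iter n f) (p k) - iter t (iter n f) (p k')|.
    move: ki; rewrite -val_eqE neq_ltn => /orP[/H//|/H[t tm et]].
    by exists t => //; rewrite distrC.
  exists (t * n)%N; last by rewrite !iterM.
  by rewrite -mulnA mulnC ltn_pmul2l.
(* At the later final time one orbit is at [x] and the other at a positive iterate of [x]. *)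
have last_case k1 k2 : (final_time k1 < final_time k2)%N -> exists2 t, (t < l.+1 * m)%N &
    e < `|iter t (iter n f) (p k1) - iter t (iter n f) (p k2)|.
  move=> lt; exists (final_time k2) => //.
  rewrite (pP k2).1; apply: lt_le_trans ee1 _.
  have -> : final_time k2 = ((final_time k2 - final_time k1).-1.+1 + final_time k1)%N by lia.
  by rewrite iterD (pP k1).1.
move=> ki.
have [lt|gt|eqf] := ltngtP (final_time k) (final_time k').
- exact: last_case.
- by have [t tm] := last_case _ _ gt; exists t => //; rewrite distrC.
have il : (i < l)%N.
  rewrite ltn_neqAle -ltnS ltn_ord andbT; apply/eqP => il.
  have iE : i = ord_max by apply: val_inj.
  by move: eqf ki; rewrite /final_time iE => /addnI ->; rewrite ltnn.
have tf : (i * m + k i <= final_time k)%N.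
  have := ltn_ord (k i); rewrite /final_time => kim.
  have : (i.+1 * m <= l * m)%N by rewrite leq_mul2r il orbT.
  by rewrite mulSn; lia.
exists (i * m + k i)%N; first exact: leq_ltn_trans tf _.
apply: lt_le_trans ee2 _.
apply: le_trans (e2P (itinerary k (i * m + k i)%N, itinerary k' (i * m + k i)%N)) _.
apply: (EP (_, _)).2 => /=; first exact: itinerary_neq.
- exact: (pP k).2.
- by apply: (pP k').2; rewrite -eqf.
Qed.

(** * Counting words with few long runs *)

(* Words with at most [r] runs, of which all but the last one and at most [l]
   others have length at most [L]. *)
Inductive few_runs (T : Type) (L : nat) : nat -> nat -> seq T -> Prop :=
| few_runs_last r l n c : few_runs L r.+1 l (nseq n c)
| few_runs_short r l n c w : (n <= L)%N -> few_runs L r l w ->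
    few_runs L r.+1 l (nseq n c ++ w)
| few_runs_long r l n c w : few_runs L r l w ->
    few_runs L r.+1 l.+1 (nseq n c ++ w).

Lemma size_flatten_le (T U : Type) (F : T -> seq U) (r : seq T) B :
  (forall x, (size (F x) <= B)%N) -> (size (flatten [seq F x | x <- r]) <= size r * B)%N.
Proof.
move=> FB; elim: r => //= x r IH; rewrite size_cat mulSn.
exact: leq_add (FB x) IH.
Qed.

(** Induction on the number of runs, splitting off the first one: a short run has at most [L + 1]
    lengths, a long one at most [n + 1], which raises the exponent, and the length of the last run
    is forced by [n]. *)
Lemma few_runs_count (T : finType) (L r : nat) : exists K, forall l n,
  exists s : seq (seq T), (size s <= K * n.+1 ^ l)%N /\
    forall w, size w = n -> few_runs L r l w -> w \in s.
Proof.
elim: r => [|r [K KP]].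
  exists 0%N => l n; exists [::]; split=> // w _ h.
  by inversion h.
have [S SP] := choice (fun p : nat * nat => KP p.1 p.2).
exists (#|T| * (1 + (L.+1 * K + K)))%N => l n.
pose ext M l' := flatten [seq flatten [seq [seq nseq m c ++ w | w <- S (l', n - m)%N]
  | m <- iota 0 M.+1] | c <- enum T].
have ext_size M l' : (size (ext M l') <= #|T| * (M.+1 * (K * n.+1 ^ l')))%N.
  rewrite cardE; apply: size_flatten_le => c.
  rewrite -[X in (_ <= X * _)%N](size_iota 0); apply: size_flatten_le => m.
  rewrite size_map; apply: leq_trans (SP (l', (n - m)%N)).1 _ => /=.
  rewrite leq_mul2l; apply/orP; right;
  by case: l' => // l'; rewrite leq_exp2r// ltnS leq_subr.
have ext_in M l' m c w : (m <= M)%N -> size (nseq m c ++ w) = n -> few_runs L r l' w ->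
    nseq m c ++ w \in ext M l'.
  move=> mM; rewrite size_cat size_nseq => wn gw.
  apply/flatten_mapP; exists c; first by rewrite mem_enum.
  apply/flatten_mapP; exists m; first by rewrite mem_iota.
  apply/mapP; exists w => //; apply: (SP (l', (n - m)%N)).2 gw => /=.
  by rewrite -wn addKn.
exists ([seq nseq n c | c <- enum T] ++ ext L l ++ if l is l'.+1 then ext n l' else [::]).
split.
  rewrite !size_cat size_map -cardE -mulnA mulnDl mulnDr mul1n.
  apply: leq_add; first by rewrite leq_pmulr// expn_gt0.
  rewrite mulnDl mulnDr; apply: leq_add.
    by apply: leq_trans (ext_size _ _) _; rewrite !mulnA.
  case: l => // l; apply: leq_trans (ext_size _ _) _.
  by rewrite expnS leq_mul2l; apply/orP; right; lia.
move=> w wn h; rewrite !mem_cat; inversion h; subst.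
- apply/orP; left; apply/mapP; exists c; first by rewrite mem_enum.
  by rewrite size_nseq.
- by apply/orP; right; apply/orP; left; exact: ext_in.
- apply/orP; right; apply/orP; right; apply: ext_in => //.
  by rewrite size_cat size_nseq leq_addr.
Qed.

(** * Upper bounds for separated sets *)

Section SepUpper.
Variables (R : realType) (f : R -> R).

(** Two points with the same word stay within [e] of each other, so a separated set injects into
    [s]. *)
Lemma sep_le (T : eqType) (pos : T -> R) (t0 : T) n e (s : seq (seq T)) :
  (forall x, 0 <= x <= 1 -> exists w, [/\ w \in s, size w = n &
    forall t, (t < n)%N -> `|iter t f x - pos (nth t0 w t)| <= e / 2]) ->
  0 <= e -> (sep n e f <= ((size s)%:R)%:E)%E.
Proof.
move=> H e0; apply: nat_sup_leP; first by rewrite lee_fin.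
move=> k [S [[S01 Ssep] Sk]]; rewrite lee_fin ler_nat.
have ex x : exists w, S x -> [/\ w \in s, size w = n &
    forall t, (t < n)%N -> `|iter t f x - pos (nth t0 w t)| <= e / 2].
  have [Sx|nSx] := pselect (S x); last by exists [::].
  have /H[w wP] : 0 <= x <= 1 by have := S01 _ Sx; rewrite /unit_itv /= in_itv.
  by exists w.
have [w wP] := choice ex.
pose h x := index (w x) s.
have hinj : {in S &, injective h}.
  move=> x y; rewrite !inE => Sx Sy hxy; apply: contrapT => xy.
  have [xs _ xw] := wP _ Sx; have [ys _ yw] := wP _ Sy.
  have wxy : w x = w y by rewrite -(nth_index [::] xs) -/(h x) hxy nth_index.
  have := Ssep x y Sx Sy xy; rewrite ltNge => /negP; apply.
  apply/bigmax_leP; split=> // t _.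
  have := xw t (ltn_ord t); have := yw t (ltn_ord t).
  by rewrite wxy !ler_distl; lra.
have : (`I_k #<= `I_(size s))%card.
  rewrite (card_le_eql card_II) -(card_le_eql Sk) -(card_le_eql (inj_card_eq hinj)).
  apply: subset_card_le => _ [x Sx <-] /=.
  by rewrite index_mem; have [] := wP _ Sx.
by rewrite card_le_II.
Qed.

Lemma sep_growth_le (l K : nat) (e : R) :
  (forall n, (sep n e f <= ((K * n.+1 ^ l)%N%:R)%:E)%E) ->
  (sep_growth f e <= (l%:R)%:E)%E.
Proof.
move=> H; apply/lee_addgt0Pr => d d0.
(* From [n + 1 <= 2 * n] one gets [K * (n + 1) ^ l <= C * n ^ l]; the successor of [K] keeps the
   logarithm of [C] meaningful. *)
pose C := (K.+1 * 2 ^ l)%N; have C0 : (0 < C)%N by rewrite muln_gt0 expn_gt0.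
pose N := maxn 2 (Num.bound (expR (ln C%:R / d) : R)).
apply: (@le_trans _ _ (ereal_sup ((fun n : nat => (lne (sep n e f) * ((ln n%:R)^-1)%:E)%E)
    @` [set n | (N <= n)%N]))).
  apply: ereal_inf_lbound; exists [set n | (N <= n)%N] => //.
  exact: nbhs_infty_ge.
apply: ge_ereal_sup => _ [n /= Nn <-].
have n2 : (2 <= n)%N by apply: leq_trans Nn; exact: leq_maxl.
have lnn : ln C%:R / d <= ln n%:R :> R.
  rewrite -[_ / d]expRK ler_ln ?posrE ?expR_gt0 ?ltr0n//; last by lia.
  apply: ltW; apply: lt_le_trans (archi_boundP (expR_ge0 _)) _.
  by rewrite ler_nat; apply: leq_trans Nn; exact: leq_maxr.
have lnn0 : 0 < ln n%:R :> R by rewrite ln_gt0// ltr1n.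
apply: (@le_trans _ _ (lne ((C * n ^ l)%N%:R%:E) * ((ln n%:R)^-1)%:E)%E).
  apply: lee_wpmul2r; first by rewrite lee_fin invr_ge0 ltW.
  apply: le_lne; apply: le_trans (H n) _; rewrite lee_fin ler_nat /C.
  rewrite -mulnA -expnMn; apply: leq_mul => //.
  by case: l {H C C0 N Nn lnn} => // l; rewrite leq_exp2r//; lia.
have Cn0 : 0 < (C * n ^ l)%N%:R :> R by rewrite ltr0n muln_gt0 C0 expn_gt0; lia.
rewrite lne_EFin// lee_fin ler_pdivrMr//.
have n0 : 0 < n%:R :> R by rewrite ltr0n; lia.
have lnE : ln (C%:R * n%:R ^+ l) = ln C%:R + ln n%:R *+ l :> R.
  by rewrite lnM ?lnXn// posrE ?exprn_gt0// ltr0n.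
rewrite natrM natrX lnE.
move: lnn; rewrite ler_pdivrMr// => lnn.
by rewrite -(mulr_natl (ln n%:R) l); lra.
Qed.

End SepUpper.

(** * Orbits near the fixed points *)

Lemma reflect_mapK (R : realType) (f : R -> R) : reflect_map (reflect_map f) = f.
Proof. by apply/funext => x; rewrite /reflect_map !subKr. Qed.

Lemma sub_oo (R : realType) (a b c d : R) : c < d ->
  `]c, d[%classic `<=` `]a, b[%classic -> a <= c /\ d <= b.
Proof.
move=> cd sub; split; rewrite leNgt; apply/negP => h.
  have /sub : `]c, d[%classic (Num.min ((c + a) / 2) ((c + d) / 2)).
    by rewrite /= in_itv /= lt_min gt_min; lra.
  by rewrite /= in_itv /= lt_min; lra.
have /sub : `]c, d[%classic (Num.max ((b + d) / 2) ((c + d) / 2)).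
  by rewrite /= in_itv /= lt_max gt_max; lra.
by rewrite /= in_itv /= gt_max; lra.
Qed.

Lemma gap_lt (R : realType) (f : R -> R) u a b : gap f u a b -> a < b.
Proof. by case: u => [/gult|/gdlt]. Qed.

Lemma gap_chain (R : realType) (f : R -> R) l (t : 'I_l -> bool * (R * R)) :
  (0 < l)%N -> (forall i, gap f (t i).1 (t i).2.1 (t i).2.2) ->
  (forall i j : 'I_l, (i < j)%N -> (t i).2 <> (t j).2) ->
  (forall i j : 'I_l, j = i.+1 :> nat ->
    `](t j).2.1, (t j).2.2[ `<=` Orb f `](t i).2.1, (t i).2.2[) ->
  chain_lengths f l.
Proof.
move=> l0 g neq link; exists (fun i => `](t i).2.1, (t i).2.2[%classic); split=> //.
- by move=> i; apply: gap_essential; have := g i; case: (t i).1; [left|right].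
- move=> i j /= e; apply/eqP/negPn/negP => ij.
  have tE : (t i).2 = (t j).2.
    have [h1 h2] : (t i).2.1 <= (t j).2.1 /\ (t j).2.2 <= (t i).2.2.
      by apply: sub_oo; [exact: gap_lt (g j)|rewrite e].
    have [h3 h4] : (t j).2.1 <= (t i).2.1 /\ (t i).2.2 <= (t j).2.2.
      by apply: sub_oo; [exact: gap_lt (g i)|rewrite e].
    rewrite (surjective_pairing (t i).2) (surjective_pairing (t j).2).
    by congr pair; apply/eqP; rewrite eq_le ?h1 ?h2 ?h3 ?h4.
  by move: ij; rewrite -val_eqE /= neq_ltn => /orP[] /neq; rewrite tE.
Qed.

Lemma chain_reflect (R : realType) (f : R -> R) l : type1_map f ->
  chain_lengths (reflect_map f) l -> chain_lengths f l.
Proof.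
move=> ft [I [l0 ess inj link]].
have gaps i : exists t : bool * (R * R), I i = `]t.2.1, t.2.2[%classic /\
    gap (reflect_map f) t.1 t.2.1 t.2.2.
  have [a [b [IE [g|g]]]] := essential_gap (type1_reflect ft) (ess i).
  - by exists (true, (a, b)).
  - by exists (false, (a, b)).
have [t tP] := choice gaps.
apply: (@gap_chain _ _ _ (fun i => (~~ (t i).1, (1 - (t i).2.2, 1 - (t i).2.1)))) => //=.
- by move=> i; rewrite -(reflect_mapK f); apply: gap_reflectb; exact: (tP i).2.
- move=> i j ij [e1 e2]; suff e : i = j by rewrite e ltnn in ij.
  apply: inj; rewrite (tP i).1 (tP j).1.
  have -> : (t i).2.1 = (t j).2.1 by lra.
  by have -> : (t i).2.2 = (t j).2.2 by lra.
- move=> i j ij y /=; rewrite in_itv /= => yt.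
  rewrite -(reflect_mapK f) -(subKr 1 y); apply: Orb_reflect.
  rewrite -(tP i).1; apply: (link i j ij); rewrite (tP j).1 /= in_itv /=; lra.
Qed.

Lemma finite_uniform (R : realType) (A : set R) (Q : R -> R -> Prop) :
  finite_set A -> (forall x r r', r' <= r -> Q x r -> Q x r') ->
  (forall x, A x -> exists r, 0 < r /\ Q x r) ->
  exists r, 0 < r /\ forall x, A x -> Q x r.
Proof.
move=> /finite_seqP[s ->] Qm; elim: s => [|x s IH] H.
  by exists 1; split=> // x; rewrite /= in_nil.
have [|r [r0 rP]] := IH; first by move=> y ys; apply: H; rewrite /= inE [y \in s]ys orbT.
have [|r' [r'0 r'P]] := H x; first by rewrite /= inE eqxx.
exists (Num.min r r'); split; first by rewrite lt_min r0.
move=> y; rewrite /= inE => /orP[/eqP ->|ys].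
- by apply: Qm r'P; rewrite ge_min lexx orbT.
- by apply: Qm (rP y ys); rewrite ge_min lexx.
Qed.

Section Drift.
Variables (R : realType) (f : R -> R) (ft : type1_map f) (l : nat).
Hypothesis nochain : ~ chain_lengths f l.+1.
Implicit Types x y z a b c d e h r s v : R.

Lemma not_away h x : 0 <= x <= 1 -> ~ away f h x ->
  exists p, [/\ 0 <= p <= 1, f p = p & `|x - p| < h].
Proof.
move=> x01 nx; apply: contrapT => np; apply: nx; split=> // p p01 fp.
by rewrite leNgt; apply/negP => xp; apply: np; exists p.
Qed.

Lemma orbit_crossing s x n v : (forall t, (t < n)%N -> `|f (iter t f x) - iter t f x| < s) ->
  x < v <= iter n f x -> exists t, (t <= n)%N /\ v <= iter t f x < v + s.
Proof.
move=> step /andP[xv vn].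
have ex : exists t, v <= iter t f x by exists n.
have [t tv tmin] := ex_minnP ex.
have tn : (t <= n)%N by exact: tmin.
exists t; split=> //; rewrite tv /=.
case: t tn tv tmin => [|t] tn tv tmin.
  by move: xv; rewrite ltNge => /negP.
have : iter t f x < v by rewrite ltNge; apply/negP => /tmin; rewrite ltnn.
have := step t tn; rewrite ltr_distl iterS; lra.
Qed.

(* A stay near the fixed points with a large displacement would visit many
   gaps of small length, each of them linked to the next one. *)
Lemma drift_up e : 0 < e -> exists h, 0 < h /\ forall x n, 0 <= x <= 1 ->
  (forall t, (t <= n)%N -> ~ away f h (iter t f x)) -> iter n f x - x <= e.
Proof.
(* A drift of [e] leaves room for [l + 1] disjoint windows of width [4 * s], each of which will
   contain the source of a gap. *)
move=> e0; pose s := e / (4 * l%:R + 4).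
have l4 : 0 < 4 * l%:R + 4 :> R by have := ler0n R l; lra.
have s0 : 0 < s by rewrite divr_gt0.
have sE : (4 * l%:R + 4) * s = e by rewrite /s mulrC divfK// gt_eqF.
have [d [d0 dP]] := t1_uc ft (e := s / 2) ltac:(lra).
exists (Num.min d (s / 2)); split; first by rewrite lt_min d0; lra.
move=> x n x01 near; rewrite leNgt; apply/negP => far.
have it01 t : 0 <= iter t f x <= 1 by exact: iter_stab.
have nearP t : (t <= n)%N -> exists p, [/\ 0 <= p <= 1, f p = p, `|iter t f x - p| < d &
    `|iter t f x - p| < s / 2].
  move=> /near /(not_away (it01 t))[p [p01 fp]].
  by rewrite lt_min => /andP[]; exists p.
have step t : (t < n)%N -> `|f (iter t f x) - iter t f x| < s.
  move=> /ltnW /nearP[p [p01 fp /(dP _ _ (it01 t) p01)]].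
  by rewrite fp !ltr_distl; lra.
(* Steps are shorter than [s], so the orbit lands in [[v, v + s)] and in [[v - 2 * s, v - s)]. The
   first landing point must still rise, so it lies in a gap moving right; a fixed point near the
   second bounds the source of that gap from below. *)
have cross v : x + 2 * s < v -> v + s < iter n f x -> exists b, exists a,
    [/\ gap_up f a b, v - 3 * s < a < v + s & reach f a b (iter n f x)].
  move=> xv vn.
  have [|t [tn tv]] := @orbit_crossing s x n v step; first by lra.
  have [|t' [t'n t'v]] := @orbit_crossing s x n (v - 2 * s) step; first by lra.
  have [p [p01 fp _]] := nearP t' t'n; rewrite ltr_distl => t'p.
  set y := iter t f x in tv; have y01 : 0 <= y <= 1 by exact: it01.
  have xn : iter n f x = iter (n - t) f y by rewrite -iterD subnK.
  have yup : y < f y.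
    rewrite ltNge; apply/negP => /(iter_le ft (n - t) y01); rewrite -xn; lra.
  have [|a [b [g yab]]] := gap_up_ex ft y01 yup; first by exists p; split=> //; lra.
  exists b, a; split=> //; last by exists y, (n - t)%N; rewrite -xn.
  apply/andP; split; last by lra.
  have [|ap] := lerP p a; first by lra.
  by have := gup g (x := p) ltac:(lra); rewrite fp ltxx.
have cr (i : 'I_l.+1) : exists ab : R * R, [/\ gap_up f ab.1 ab.2,
    x + (4 * i%:R) * s < ab.1 < x + (4 * i%:R + 4) * s & reach f ab.1 ab.2 (iter n f x)].
  have il : i%:R <= l%:R :> R by rewrite ler_nat -ltnS.
  have i0 := ler0n R i.
  have is0 : 0 <= i%:R * s by apply: mulr_ge0 => //; lra.
  have ils : i%:R * s <= l%:R * s by rewrite ler_pM2r.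
  have [||b [a [g av r]]] := cross (x + (4 * i%:R + 3) * s); try lra.
  by exists (a, b); split=> //=; lra.
have [ab abP] := choice cr.
apply: nochain; apply: (@gap_chain _ _ _ (fun i => (true, ab i))) => //=.
- by move=> i; have [] := abP i.
- move=> i j ij eab; have [_ h1 _] := abP i; have [_ h2 _] := abP j.
  have ijR : i%:R + 1 <= j%:R :> R by rewrite natr1 ler_nat.
  have : (i%:R + 1) * s <= j%:R * s by rewrite ler_pM2r.
  by rewrite eab in h1; lra.
- move=> i j ij; have [g1 h1 r1] := abP i; have [g2 h2 r2] := abP j.
  have ijR : j%:R = i%:R + 1 :> R by rewrite natr1 ij.
  have jl : j%:R * s <= l%:R * s by rewrite ler_pM2r// ler_nat -ltnS.
  rewrite ijR in h2 jl.
  by apply: (gap_link_up ft g1 g2) r1; lra.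
Qed.

(** If an orbit passes through the gap and later visits [away f h], then the gap reaches [a + h]; so
    these are the sources that matter for charging. *)
Definition far_sources (h : R) : set R :=
  [set a | exists b, gap_up f a b /\ reach f a b (a + h)].

(* Far-reaching gaps with sources closer than [h] are linked from left to
   right. *)
Lemma finite_far_sources h : 0 < h -> finite_set (far_sources h).
Proof.
move=> h0; pose P (J : set R) := finite_set (far_sources h `&` J).
have [||x x01|] := @itv01_local _ P.
- by move=> A B AB; apply: sub_finite_set; exact: setIS.
- by move=> A B PA PB; rewrite /P setIUr finite_setU.
- exists (h / 2); split; first by lra.
  apply: contrapT => /(infinite_set_fset l.+1)[B BA Bl].
  pose s := sort <=%R (finmap.enum_fset B).
  have ssz : (l < size s)%N by rewrite size_sort.
  have ss : sorted <%R s.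
    by rewrite lt_sorted_uniq_le sort_uniq finmap.fset_uniq sort_le_sorted.
  have sB (i : 'I_l.+1) : (far_sources h `&` [set y | `|y - x| < h / 2]) (nth 0 s i).
    apply: BA => /=; rewrite -(mem_sort <=%R) mem_nth//.
    exact: leq_trans ssz.
  have sb (i : 'I_l.+1) : exists b, gap_up f (nth 0 s i) b /\
      reach f (nth 0 s i) b (nth 0 s i + h) by have [] := sB i.
  have [b bP] := choice sb.
  have slt (i j : 'I_l.+1) : (i < j)%N -> nth 0 s i < nth 0 s j.
    move=> ij; rewrite (lt_sorted_ltn_nth 0 ss) ?inE //.
    - exact: leq_trans ssz.
    - exact: leq_trans ssz.
  apply: nochain; apply: (@gap_chain _ _ _ (fun i => (true, (nth 0 s i, b i)))) => //=.
  + by move=> i; exact: (bP i).1.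
  + by move=> i j /slt ij [e _]; move: ij; rewrite e ltxx.
  + move=> i j ij; have sij : nth 0 s i < nth 0 s j by apply: slt; rewrite ij.
    apply: (gap_link_up ft (bP i).1 (bP j).1 _ _ (bP i).2); first exact: ltW.
    by have [_] := sB i; have [_] := sB j; rewrite /= !ltr_distl; lra.
- move=> n fin; apply: (sub_finite_set _ (ex_intro _ n fin)) => a aE; split=> //; case: aE => b [g _] /=.
  by have := gu0 g; have := gu1 g; have := gult g; lra.
Qed.

End Drift.

(** * Long stays pass near a source *)

Section Charges.
Variables (R : realType) (f : R -> R) (ft : type1_map f).
Implicit Types x y z a b c d e h p q r v : R.

Lemma away_reflect h x : away (reflect_map f) h (1 - x) <-> away f h x.
Proof.
split=> -[x01 far]; split; try lra; move=> p p01 fp.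
- have := far (1 - p) ltac:(lra); rewrite /reflect_map subKr fp.
  have -> : 1 - x - (1 - p) = - (x - p) by ring.
  by rewrite normrN; apply.
- have := far (1 - p) ltac:(lra) ltac:(move: fp; rewrite /reflect_map; lra).
  have -> : 1 - x - p = - (x - (1 - p)) by ring.
  by rewrite normrN.
Qed.

(* [t = (u, (a, b))] stands for the gap of endpoints [a < b] in which the points
   move to the right if [u] and to the left otherwise. *)
Definition near_source r x (t : bool * (R * R)) : Prop :=
  [/\ gap f t.1 t.2.1 t.2.2, t.2.1 < x < t.2.2 &
      `|x - source t.1 t.2.1 t.2.2| < r].

(* If the orbit of [z] is near a fixed point [p] in front of it, it can only
   leave the neighbourhood by jumping over [p] into a gap with source behind
   the landing point. *)
Lemma leave_up h r r' z p k : 0 < r' -> r' <= r -> r <= h ->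
  (forall x y, 0 <= x <= 1 -> 0 <= y <= 1 -> `|x - y| < r' -> `|f x - f y| < r) ->
  0 <= z <= 1 -> z < f z -> 0 <= p <= 1 -> f p = p -> `|z - p| < r' ->
  away f h (iter k f z) ->
  exists u, (u < k)%N /\ exists t, near_source r (iter u f z) t.
Proof.
move=> r'0 r'r rh uc z01 zup p01 fp zp [_ far].
have zk := iter_ge ft k z01 (ltW zup).
have it01 t : 0 <= iter t f z <= 1 by exact: iter_stab.
have gapz y q : 0 <= y <= 1 -> y < f y -> 0 <= q < y -> f q = q -> y - q < r ->
    exists t, near_source r y t.
  move=> y01 yup qy fq yq.
  have [|a [b [g yab]]] := gap_up_ex ft y01 yup; first by exists q; split=> //; lra.
  exists (true, (a, b)); split=> //=.
  have [qa|aq] := lerP q a; first by rewrite ltr_distl; lra.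
  by have := gup g (x := q) ltac:(lra); rewrite fq ltxx.
have farp := far _ p01 fp.
have k0 : (0 < k)%N.
  case: k farp {far zk} => //= farp; move: zp; rewrite ltNge => /negP; case.
  by apply: le_trans farp; apply: le_trans r'r _.
rewrite ltr_distl in zp.
have [pz|zp'] := ltP p z.
  by exists 0%N; split=> //; apply: (gapz z p) => //; lra.
have zltp : z < p.
  by rewrite lt_neqAle zp' andbT; apply/eqP => e; move: zup; rewrite e fp ltxx.
have exs : exists s, p <= iter s f z.
  exists k; rewrite leNgt; apply/negP => kp.
  by move: farp; rewrite ltr0_norm; lra.
have [s ps smin] := ex_minnP exs.
have sk : (s <= k)%N.
  apply: smin; rewrite leNgt; apply/negP => kp.
  by move: farp; rewrite ltr0_norm; lra.
case: s ps smin sk => [|s] ps smin sk; first by move: ps => /=; lra.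
have sp : iter s f z < p by rewrite ltNge; apply/negP => /smin; rewrite ltnn.
have zs := iter_ge ft s z01 (ltW zup).
have := uc (iter s f z) p (it01 s) p01; rewrite fp !ltr_distl => /(_ ltac:(lra)) yp.
have [y yE] : exists y, y = iter s.+1 f z by exists (iter s.+1 f z).
rewrite -iterS -yE in yp; rewrite -yE in ps.
have y01 : 0 <= y <= 1 by rewrite yE.
have ky : iter k f z = iter (k - s.+1) f y by rewrite yE -iterD subnK.
(* If [y] did not move right, the later orbit would remain between [z] and [y], hence within [h] of
   [p]. *)
have yup : y < f y.
  rewrite ltNge; apply/negP => /(iter_le ft (k - s.+1) y01); rewrite -ky => ykle.
  by move: farp; rewrite ler_normr => /orP[]; lra.
exists s.+1; split.
  rewrite ltn_neqAle sk andbT; apply/eqP => e.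
  by move: farp; rewrite -e -yE ler_normr => /orP[]; lra.
rewrite -yE; apply: (gapz y p) => //; last by lra.
apply/andP; split; first by lra.
by rewrite lt_neqAle ps andbT; apply/eqP => e; move: yup; rewrite -e fp ltxx.
Qed.

End Charges.

Definition flip (R : realType) (t : bool * (R * R)) := (~~ t.1, (1 - t.2.2, 1 - t.2.1)).

Lemma near_source_reflect (R : realType) (f : R -> R) r y t :
  near_source f r y t -> near_source (reflect_map f) r (1 - y) (flip t).
Proof.
case: t => u [a b] [] /= g yab ys; split=> /=; first exact: gap_reflectb.
  by lra.
by move: ys; case: u {g} => /=; rewrite !ltr_distl; lra.
Qed.

Section Charges2.
Variables (R : realType) (f : R -> R) (ft : type1_map f).
Implicit Types x y z a b c d e h p q r v : R.

(** A stay exceeding the bound on visits to [away f r'] comes within [r'] of some fixed point, and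
    [leave_up] applies from that moment, directly or after reflection. *)
Lemma long_stay h r : 0 < r -> r <= h -> exists L, forall x j, 0 <= x <= 1 ->
  (L < j)%N -> (forall t, (t < j)%N -> ~ away f h (iter t f x)) ->
  away f h (iter j f x) -> exists u, (u < j)%N /\ exists t, near_source f r (iter u f x) t.
Proof.
move=> r0 rh; have [d [d0 dP]] := t1_uc ft r0.
pose r' := Num.min d r.
have r'0 : 0 < r' by rewrite lt_min d0.
have r'r : r' <= r by rewrite ge_min lexx orbT.
have uc x y : 0 <= x <= 1 -> 0 <= y <= 1 -> `|x - y| < r' -> `|f x - f y| < r.
  by move=> x01 y01; rewrite lt_min => /andP[xd _]; exact: dP.
have [L LP] := visits_away ft r'0.
exists L => x j x01 Lj near far.
have it01 t : 0 <= iter t f x <= 1 by exact: iter_stab.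
have [t [tj nt]] : exists t, (t < j)%N /\ ~ away f r' (iter t f x).
  apply: contrapT => nt; have := LP x j x01.
  rewrite /visits (eq_bigr (fun=> 1%N)); last first.
    by move=> i _; rewrite asboolT//; apply: contrapT => ni; apply: nt; exists i.
  by rewrite sum1_card card_ord leqNgt Lj.
have [p [p01 fp tp]] := not_away (it01 t) nt.
set z := iter t f x in tp; have z01 : 0 <= z <= 1 by exact: it01.
have jE : iter j f x = iter (j - t) f z by rewrite -iterD subnK// ltnW.
rewrite jE in far.
have nz : f z <> z.
  move=> fz; have [_ /(_ z z01 fz)] := far.
  by rewrite iter_fix// subrr normr0; lra.
suff [u [uj ns]] : exists u, (u < j - t)%N /\ exists t, near_source f r (iter u f z) t.
  exists (u + t)%N; split; first by rewrite addnC -ltn_subRL.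
  by rewrite iterD.
move/eqP: nz; rewrite neq_lt => /orP[zdn|zup]; last first.
  exact: (leave_up ft r'0 r'r rh uc z01 zup p01 fp tp far).
have := @leave_up _ _ (type1_reflect ft) h r r' (1 - z) (1 - p) (j - t) r'0 r'r rh.
case.
- move=> a b a01 b01 ab; rewrite /reflect_map.
  have := uc (1 - a) (1 - b) ltac:(lra) ltac:(lra).
  have -> : 1 - a - (1 - b) = - (a - b) by ring.
  have -> : 1 - f (1 - a) - (1 - f (1 - b)) = - (f (1 - a) - f (1 - b)) by ring.
  by rewrite !normrN; exact.
- by lra.
- by rewrite /reflect_map subKr; lra.
- by lra.
- by rewrite /reflect_map subKr fp.
- have -> : 1 - z - (1 - p) = - (z - p) by ring.
  by rewrite normrN.
- by rewrite iter_reflect subKr; apply/away_reflect.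
- move=> u [uj [s /near_source_reflect]].
  rewrite reflect_mapK iter_reflect !subKr => ns.
  by exists u; split=> //; exists (flip s).
Qed.
End Charges2.

(** * Successive charged gaps are linked *)

(** The margin in [reach_dichotomy] depends on the two gaps. There are finitely many far sources on
    either side, and a source with a direction determines its gap, so a smallest margin exists. *)
Lemma reach_source_uniform (R : realType) (f : R -> R) l (h : R) : type1_map f ->
  ~ chain_lengths f l.+1 -> 0 < h -> exists r : R, 0 < r /\
  forall a b c d, gap_up f a b -> reach f a b (a + h) -> gap_dn f c d ->
    reach (reflect_map f) (1 - d) (1 - c) (1 - d + h) ->
    reach f a b d \/ forall v, reach f a b v -> v <= d - r.
Proof.
move=> ft nochain h0.
have nochain' : ~ chain_lengths (reflect_map f) l.+1 by move=> /(chain_reflect ft).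
pose Q a d' r := forall b c, gap_up f a b -> gap_dn f c (1 - d') ->
  reach f a b (1 - d') \/ forall v, reach f a b v -> v <= 1 - d' - r.
have Qm a d' r r' : r' <= r -> Q a d' r -> Q a d' r'.
  move=> rr' H b c g g'; have [?|H'] := H b c g g'; [by left|right => v /H'; lra].
have Qex a d' : exists r, 0 < r /\ Q a d' r.
  have [[b [c [g g']]]|nex] := pselect (exists b c, gap_up f a b /\ gap_dn f c (1 - d')).
    have [rd|[r [r0 rP]]] := reach_dichotomy ft g g'.
      by exists 1; split=> // b' c' /(gap_up_inj g) <-; left.
    by exists r; split=> // b' c' /(gap_up_inj g) <-; right.
  by exists 1; split=> // b c g g'; case: nex; exists b, c.
have [||r [r0 rP]] := @finite_uniform _ _ (fun a r => forall d',
    far_sources (reflect_map f) h d' -> Q a d' r) (finite_far_sources ft nochain h0).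
- by move=> a r r' rr' H d' /H; exact: Qm.
- move=> a _; apply: (finite_uniform (finite_far_sources (type1_reflect ft) nochain' h0)).
    by move=> d' r r'; exact: Qm.
  by move=> d' _; exact: Qex.
exists r; split=> // a b c d g rg g' rg'.
have fa : far_sources f h a by exists b.
have fd : far_sources (reflect_map f) h (1 - d).
  by exists (1 - c); split=> //; apply/gap_reflect.
by have := rP a fa (1 - d) fd b c g; rewrite subKr; apply.
Qed.

Section ChargeLinks.
Variables (R : realType) (f : R -> R) (ft : type1_map f) (h r : R).
Hypothesis uc : forall x y : R, 0 <= x <= 1 -> 0 <= y <= 1 -> `|x - y| < r -> `|f x - f y| < h.
Hypothesis rP : forall a b c d : R, gap_up f a b -> reach f a b (a + h) -> gap_dn f c d ->
    reach (reflect_map f) (1 - d) (1 - c) (1 - d + h) ->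
    reach f a b d \/ forall v, reach f a b v -> v <= d - r.

(* After a visit far from the fixed points, an orbit which was near a source
   [a], in the gap to its right, does not come back there: the last point
   before the visit which moves to the right would be near [a] and then the
   visited point between [a] and its image. *)
Lemma no_return_up (a b y : R) m n : (m <= n)%N -> gap_up f a b -> a < y < b ->
  away f h (iter m f y) -> a + r <= iter n f y.
Proof.
move=> mn g yab [_ far]; have [a0 b1 ab fa fb up] := g.
rewrite leNgt; apply/negP => nr; have {}far := far a ltac:(lra) fa.
have y01 : 0 <= y <= 1 by lra.
have it01 t : 0 <= iter t f y <= 1 by exact: iter_stab.
have my := iter_ge ft m y01 (ltW (up _ yab)).
rewrite ger0_norm in far; last by lra.
pose P k := (k <= m)%N && (iter k f y < f (iter k f y)).
have P0 : exists k, P k by exists 0%N; rewrite /P /= up.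
have [|k /andP[km kup] kmax] := ex_maxnP P0 (m := m); first by move=> k /andP[].
have ky := iter_ge ft k y01 (ltW (up _ yab)).
have kn : iter k f y <= iter n f y.
  rewrite -(subnK (leq_trans km mn)) iterD; apply: iter_ge => //; exact: ltW.
have kd : `|iter k f y - a| < r by rewrite ltr_distl; lra.
move: (uc (it01 k) (y := a) ltac:(lra) kd); rewrite fa ltr_distl => fk.
move: km; rewrite leq_eqVlt => /orP[/eqP km|km]; first by move: far; rewrite -km; lra.
have : ~ iter k.+1 f y < f (iter k.+1 f y).
  move=> up1; have := kmax k.+1; rewrite /P km up1 => /(_ isT).
  by rewrite ltnn.
move=> /negP; rewrite -leNgt => /(iter_le ft (m - k.+1) (it01 k.+1)).
rewrite -iterD subnK// iterS; move: far fk; lra.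
Qed.

(** A second gap moving right starts beyond [a] by [no_return_up]. For one moving left with source
    [d], the orbit of the first gap gets above [d - r], so by [rP] it reaches [d]. *)
Lemma charge_link_up (a b y : R) m m' n t : gap_up f a b -> a < y < b ->
  `|y - a| < r -> (m <= n)%N -> away f h (iter m f y) ->
  near_source f r (iter n f y) t -> away f h (iter m' f (iter n f y)) ->
  t.2 <> (a, b) /\ `]t.2.1, t.2.2[ `<=` Orb f `]a, b[.
Proof.
move=> g yab ya mn far [g' y'ab y's] far'; have [a0 b1 ab fa fb up] := g.
have y01 : 0 <= y <= 1 by lra.
have noret := no_return_up mn g yab far.
have yn := iter_ge ft n y01 (ltW (up _ yab)).
have rn : reach f a b (iter n f y) by exists y, n.
have between c d : c < iter n f y -> (forall x, c < x < d -> f x <> x) -> iter n f y < d -> a <= c.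
  move=> cy nf yd; rewrite leNgt; apply/negP => ca; apply: (nf a) fa; lra.
case: t g' y'ab y's => u [c d] /= g' y'ab y's; rewrite ltr_distl in y's.
have ac : a <= c.
  apply: (between c d); try lra; move=> x xcd.
  by case: u g' {y's} => /= g'; [have := gup g' xcd|have := gdn g' xcd]; lra.
case: u g' y's => /= g' y's.
  split; last by apply: (gap_link_up ft g g' ac) rn; lra.
  by move=> [ca _]; lra.
split.
  move=> [ca db]; have [_ _ _ _ _ dn] := g'.
  by have := dn y ltac:(lra); have := up y yab; lra.
apply: (gap_link_dn ft g ac).
have d01 : 0 <= c /\ d <= 1 by have := gd0 g'; have := gd1 g'.
have reach_far : reach f a b (a + h).
  have [_ /(_ a ltac:(lra) fa)] := far.
  have my := iter_ge ft m y01 (ltW (up _ yab)).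
  by rewrite ger0_norm => [am|]; [exists y, m; split=> //; lra|lra].
have reach_far' : reach (reflect_map f) (1 - d) (1 - c) (1 - d + h).
  have [_ /(_ d ltac:(lra) (gdfr g'))] := far'.
  have y'01 : 0 <= iter n f y <= 1 by lra.
  have my := iter_le ft m' y'01 (ltW (gdn g' y'ab)).
  rewrite ler0_norm => [dm|]; last by lra.
  exists (1 - iter n f y), m'; rewrite iter_reflect subKr; split; lra.
have [//|/(_ _ rn)] := rP g reach_far g' reach_far'.
by move: y's; lra.
Qed.
End ChargeLinks.

Lemma charge_link (R : realType) (f : R -> R) l (h : R) : type1_map f -> 0 < h ->
  ~ chain_lengths f l.+1 -> exists r : R, [/\ 0 < r, r <= h &
    forall (y : R) m m' n s t, 0 <= y <= 1 -> near_source f r y s -> (m <= n)%N ->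
      away f h (iter m f y) ->
      near_source f r (iter n f y) t -> away f h (iter m' f (iter n f y)) ->
      s.2 <> t.2 /\ `]t.2.1, t.2.2[ `<=` Orb f `]s.2.1, s.2.2[].
Proof.
move=> ft h0 nochain.
have nochain' : ~ chain_lengths (reflect_map f) l.+1 by move=> /(chain_reflect ft).
have [d [d0 dP]] := t1_uc ft h0.
have [d' [d'0 d'P]] := t1_uc (type1_reflect ft) h0.
have [r1 [r10 r1P]] := reach_source_uniform ft nochain h0.
have [r2 [r20 r2P]] := reach_source_uniform (type1_reflect ft) nochain' h0.
have [r [r0 [rh rr1 rr2 rd rd']]] : exists r : R, 0 < r /\ [/\ r <= h, r <= r1, r <= r2, r <= d & r <= d'].
  exists (Num.min h (Num.min r1 (Num.min r2 (Num.min d d')))).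
  by rewrite !lt_min h0 r10 r20 d0 d'0; split=> //; split;
    rewrite !ge_min lexx ?orbT.
exists r; split=> // y m m' n [u [a b]] t y01 [/= g yab ys] mn far ns far'.
case: u g ys => /= g ys.
  have [||h1 h2] := @charge_link_up _ f ft h r _ _ a b y m m' n t g yab ys mn far ns far'.
  - by move=> x z x01 z01 xz; apply: dP => //; exact: lt_le_trans xz rd.
  - move=> a' b' c' e' g1 re1 g2 re2; have [?|H] := r1P _ _ _ _ g1 re1 g2 re2; first by left.
    by right => v /H; lra.
  by split=> // e; apply: h1.
have g' : gap_up (reflect_map f) (1 - b) (1 - a) by apply/gap_reflect.
have ns' := near_source_reflect ns.
have itr k x : iter k (reflect_map f) (1 - x) = 1 - iter k f x by rewrite iter_reflect subKr.
have [||||||||h1 h2] := @charge_link_up _ _ (type1_reflect ft) h r _ _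
  (1 - b) (1 - a) (1 - y) m m' n (flip t) g'.
- by move=> x z x01 z01 xz; apply: d'P => //; exact: lt_le_trans xz rd'.
- move=> a' b' c' e' g1 re1 g2 re2; have [?|H] := r2P _ _ _ _ g1 re1 g2 re2; first by left.
  by right => v /H; lra.
- by lra.
- have -> : 1 - y - (1 - b) = - (y - b) by ring.
  by rewrite normrN.
- exact: mn.
- by rewrite itr; apply/away_reflect.
- by rewrite itr.
- by rewrite itr itr; apply/away_reflect.
split; first by move=> e; apply: h1; rewrite /flip -e.
move=> x xt; rewrite -(reflect_mapK f) -[a](subKr 1) -[b](subKr 1) -(subKr 1 x).
apply: Orb_reflect; apply: h2; move: xt; rewrite /= !in_itv /=; lra.
Qed.

(** * Coding orbits by words *)

Section Words.
Variables (R : realType) (f : R -> R) (ft : type1_map f) (h r : R).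

(** A charge pays for one long stay. Successive charges occupy disjoint stretches of time, which
    lets [link] turn their gaps into a chain. *)
Fixpoint charges (k : nat) (x : R) : Prop :=
  if k is k'.+1 then exists u e t, [/\ (u < e)%N, near_source f r (iter u f x) t,
    away f h (iter e f x) & charges k' (iter e.+1 f x)]
  else True.

Lemma chargesP k x : charges k x -> exists (u e : nat -> nat) (t : nat -> bool * (R * R)),
  forall i, (i < k)%N -> [/\ (u i < e i)%N, near_source f r (iter (u i) f x) (t i),
    away f h (iter (e i) f x) & forall j, (i < j < k)%N -> (e i < u j)%N].
Proof.
elim: k x => [|k IH] x /=; first by exists id, id, (fun=> (true, (0, 0))).
move=> [u0 [e0 [t0 [ue ns far /IH[u [e [t H]]]]]]].
exists (fun i => if i is i'.+1 then (u i' + e0.+1)%N else u0),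
  (fun i => if i is i'.+1 then (e i' + e0.+1)%N else e0),
  (fun i => if i is i'.+1 then t i' else t0).
move=> [_|i]; first by split=> // -[//|j] _; lia.
rewrite ltnS => /H[h1 h2 h3 h4]; split; rewrite ?iterD //; first by lia.
by move=> [//|j]; rewrite !ltnS => /h4; lia.
Qed.

Hypothesis link : forall (y : R) m m' n s t, 0 <= y <= 1 -> near_source f r y s -> (m <= n)%N ->
  away f h (iter m f y) ->
  near_source f r (iter n f y) t -> away f h (iter m' f (iter n f y)) ->
  s.2 <> t.2 /\ `]t.2.1, t.2.2[ `<=` Orb f `]s.2.1, s.2.2[.

Lemma charges_chain k x : 0 <= x <= 1 -> charges k.+1 x -> chain_lengths f k.+1.
Proof.
move=> x01 /chargesP[u [e [t H]]].
have lk i j : (i < j < k.+1)%N -> (t i).2 <> (t j).2 /\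
    `](t j).2.1, (t j).2.2[ `<=` Orb f `](t i).2.1, (t i).2.2[.
  move=> /andP[ij jk]; have [ue1 ns1 far1 /(_ j)] := H i (ltn_trans ij jk).
  rewrite ij jk => /(_ isT) eu; have [ue2 ns2 far2 _] := H j jk.
  have it m n : (m <= n)%N -> iter (n - m) f (iter m f x) = iter n f x.
    by move=> mn; rewrite -iterD subnK.
  apply: (@link (iter (u i) f x) (e i - u i) (e j - u j) (u j - u i)) => //.
  - exact: iter_stab.
  - by lia.
  - by rewrite it// ltnW.
  - by rewrite it//; lia.
  - by rewrite it; [rewrite it// ltnW|lia].
apply: (@gap_chain _ _ _ (fun i : 'I_k.+1 => t i)) => //.
- by move=> i; have [_ []] := H i (ltn_ord i).
- by move=> i j ij; apply: (lk i j _).1; rewrite ij ltn_ord.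
- by move=> i j ij; apply: (lk i j _).2; rewrite ij ltnS leqnn -ij ltn_ord.
Qed.

Lemma charges_iter k m x : charges k (iter m f x) -> charges k x.
Proof.
case: k => // k [u [e [t [ue ns far ch]]]]; exists (u + m)%N, (e + m)%N, t.
by rewrite ltn_add2r -addSn !iterD.
Qed.

Variables (Q : nat) (pos : 'I_Q.+1 -> R) (cell : R -> 'I_Q.+1) (e : R).
Hypothesis e0 : 0 < e.
Hypothesis cellP : forall x, 0 <= x <= 1 -> `|x - pos (cell x)| <= e.
Hypothesis drift : forall x n, 0 <= x <= 1 ->
  (forall t, (t <= n)%N -> ~ away f h (iter t f x)) -> `|iter n f x - x| <= e.
Variable L : nat.
Hypothesis L0 : (0 < L)%N.
Hypothesis stay : forall x j, 0 <= x <= 1 ->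
  (L < j)%N -> (forall t, (t < j)%N -> ~ away f h (iter t f x)) ->
  away f h (iter j f x) -> exists u, (u < j)%N /\ exists t, near_source f r (iter u f x) t.

(* The word follows the orbit: it is constant during the stays near the fixed
   points, and a long stay followed by a visit far from them is charged. *)
Lemma shadowing_word v n x k : 0 <= x <= 1 -> (visits f (away f h) x n <= v)%N ->
  ~ charges k.+1 x -> exists w, [/\ size w = n, few_runs L v.*2.+1 k w &
    forall t, (t < n)%N -> `|iter t f x - pos (nth ord0 w t)| <= e + e].
Proof.
have near_word x' m : 0 <= x' <= 1 -> (forall t, (t < m)%N -> ~ away f h (iter t f x')) ->
    forall t, (t < m)%N -> `|iter t f x' - pos (nth ord0 (nseq m (cell x')) t)| <= e + e.
  move=> x'01 near t tm; rewrite nth_nseq tm.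
  have := @drift x' t x'01; have := cellP x'01; rewrite !ler_distl => c1 c2.
  have {}c2 : x' - e <= iter t f x' <= x' + e.
    by apply: c2 => s st; apply: near; exact: leq_ltn_trans tm.
  by move: c1 c2; lra.
elim: v n x k => [|v IH] n x k x01 vis nch.
  exists (nseq n (cell x)); split; rewrite ?size_nseq //; first exact: few_runs_last.
  apply: near_word => // t tn far; move: vis; rewrite leqn0 /visits sum_nat_eq0.
  by move=> /forallP/(_ (Ordinal tn)); rewrite asboolT.
have [near|] := pselect (forall t, (t < n)%N -> ~ away f h (iter t f x)).
  exists (nseq n (cell x)); split; rewrite ?size_nseq //; first exact: few_runs_last.
  exact: near_word.
move=> nnear; have ex : exists t, (t < n)%N && `[< away f h (iter t f x) >].
  apply: contrapT => ne; apply: nnear => t tn far; apply: ne; exists t.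
  by rewrite tn asboolT.
have [j /andP[jn /asboolP far] jmin] := ex_minnP ex.
have near t : (t < j)%N -> ~ away f h (iter t f x).
  move=> tj ft'; suff : (j <= t)%N by rewrite leqNgt tj.
  by apply: jmin; rewrite (ltn_trans tj jn) asboolT.
have n_eq : n = (j + (1 + (n - j.+1)))%N by lia.
have jx01 : 0 <= iter j f x <= 1 by exact: iter_stab.
have jx01' : 0 <= iter j.+1 f x <= 1 by exact: iter_stab.
have vis' : (visits f (away f h) (iter j.+1 f x) (n - j.+1) <= v)%N.
  move: vis; rewrite {1}n_eq !visitsD {2}/visits big_ord_recl big_ord0 /= asboolT//.
  by lia.
(* A stay and the visit ending it give two runs, whence the count [v.*2.+1]; the run of the visit
   has length 1 and is short. *)
have build k' k'' w' : size w' = (n - j.+1)%N -> few_runs L v.*2.+1 k' w' ->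
    (forall t, (t < n - j.+1)%N -> `|iter t f (iter j.+1 f x) - pos (nth ord0 w' t)| <= e + e) ->
    (few_runs L v.*2.+2 k' (nseq 1 (cell (iter j f x)) ++ w') ->
     few_runs L v.*2.+3 k'' (nseq j (cell x) ++ nseq 1 (cell (iter j f x)) ++ w')) ->
    exists w, [/\ size w = n, few_runs L v.+1.*2.+1 k'' w &
      forall t, (t < n)%N -> `|iter t f x - pos (nth ord0 w t)| <= e + e].
  move=> sw fw posw run; exists (nseq j (cell x) ++ nseq 1 (cell (iter j f x)) ++ w'); split.
  - by rewrite !size_cat !size_nseq sw -n_eq.
  - by apply: run; apply: few_runs_short.
  move=> t tn; rewrite nth_cat size_nseq; case: ltnP => tj; first exact: near_word.
  rewrite nth_cat size_nseq; case: ltnP => tj1.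
    have -> : t = j by lia.
    by rewrite subnn /=; apply: le_trans (cellP jx01) _; rewrite lerDl ltW.
  have := posw (t - j.+1)%N; rewrite -iterD subnK; last by lia.
  by rewrite -subnDA addn1 => -> //; lia.
have [jL|Lj] := leqP j L.
  have [|w' [sw fw posw]] := IH (n - j.+1)%N (iter j.+1 f x) k jx01' vis'.
    by move=> /charges_iter.
  by apply: build sw fw posw _; exact: few_runs_short.
(* A long stay uses up one charge, so the rest of the orbit admits one charge fewer. *)
have [u [uj [t ns]]] := stay x01 Lj near far.
have nch' : ~ charges k (iter j.+1 f x).
  by move=> ch; apply: nch; exists u, j, t.
case: k nch nch' => [|k] nch nch'; first by case: nch'.
have [w' [sw fw posw]] := IH (n - j.+1)%N (iter j.+1 f x) k jx01' vis' nch'.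
by apply: build sw fw posw _; exact: few_runs_long.
Qed.

End Words.

Lemma drift_le (R : realType) (f : R -> R) l (e : R) : type1_map f ->
  ~ chain_lengths f l.+1 -> 0 < e -> exists h, 0 < h /\ forall x n, 0 <= x <= 1 ->
  (forall t, (t <= n)%N -> ~ away f h (iter t f x)) -> `|iter n f x - x| <= e.
Proof.
move=> ft nochain e0.
have nochain' : ~ chain_lengths (reflect_map f) l.+1 by move=> /(chain_reflect ft).
have [h [h0 hP]] := drift_up ft nochain e0.
have [h' [h'0 h'P]] := drift_up (type1_reflect ft) nochain' e0.
have away_le k k' x : k' <= k -> away f k x -> away f k' x.
  by move=> kk [x01 far]; split=> // p p01 /(far p p01); exact: le_trans.
exists (Num.min h h'); split; first by rewrite lt_min h0.
move=> x n x01 near; rewrite ler_distl.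
have := hP x n x01 => /(_ _)/wrap[].
  by move=> t /near nt; apply: contra_not nt; apply: away_le; rewrite ge_min lexx.
have := h'P (1 - x) n ltac:(lra) => /(_ _)/wrap[].
  move=> t /near nt; apply: contra_not nt; rewrite iter_reflect subKr => /away_reflect.
  by apply: away_le; rewrite ge_min lexx orbT.
rewrite iter_reflect subKr; lra.
Qed.

(** * Upper bound for the entropy, and conclusion *)

Lemma hpol_le_chain (R : realType) (f : R -> R) l : type1_map f ->
  ~ chain_lengths f l.+1 -> (hpol f <= (l%:R)%:E)%E.
Proof.
move=> ft nochain; apply: hpol_le => e e0.
(* The grid and the drift each contribute an error [e / 4], giving the precision [e / 2] that
   [sep_le] asks for. *)
have e4 : 0 < e / 4 by lra.
have [h [h0 drift]] := drift_le ft nochain e4.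
have [r [r0 rh link]] := charge_link ft h0 nochain.
have [L LP] := long_stay ft r0 rh.
have [M MP] := visits_away ft h0.
pose Q := Num.bound (e / 4)^-1.
have Q0 : 0 < Q%:R :> R by apply: le_lt_trans (archi_boundP _) ; rewrite ?invr_ge0 ltW // invr_gt0.
pose pos (i : 'I_Q.+1) : R := i%:R / Q%:R.
pose cell (x : R) : 'I_Q.+1 := inord (Num.truncn (x * Q%:R)).
have cellP x : 0 <= x <= 1 -> `|x - pos (cell x)| <= e / 4.
  move=> x01; have xQ : 0 <= x * Q%:R by apply: mulr_ge0; [lra|exact: ltW].
  have /andP[t1 t2] := Num.Theory.truncn_itv xQ.
  have tQ : (Num.truncn (x * Q%:R) < Q.+1)%N.
    rewrite ltnS -(ler_nat R); apply: le_trans t1 _.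
    by rewrite -[leRHS]mul1r ler_pM2r//; lra.
  have Qe : Q%:R^-1 <= e / 4.
    rewrite -[e / 4]invrK lef_pV2 ?posrE ?invr_gt0//.
    by apply/ltW/archi_boundP; rewrite invr_ge0 ltW.
  rewrite /pos /cell inordK// ler_distl.
  have h1 : (Num.truncn (x * Q%:R))%:R / Q%:R <= x by rewrite ler_pdivrMr.
  have h2 : x < (Num.truncn (x * Q%:R)).+1%:R / Q%:R by rewrite ltr_pdivlMr.
  move: h2; rewrite -natr1 mulrDl mul1r; move: h1 Qe e4; clear; lra.
have [K KP] := few_runs_count 'I_Q.+1 L.+1 M.*2.+1.
apply: (@sep_growth_le _ _ l K) => n.
have [s [ss sP]] := KP l n.
apply: (@le_trans _ _ ((size s)%:R)%:E); last by rewrite lee_fin ler_nat.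
apply: (@sep_le _ _ _ pos ord0); last exact: ltW.
move=> x x01.
have [||w [sw fw posw]] := @shadowing_word _ f ft h r Q pos cell (e / 4) e4 cellP drift L.+1 isT
  _ M n x l x01 (MP x n x01).
- by move=> y j y01 Lj; apply: LP => //; exact: ltn_trans Lj.
- by move=> /(charges_chain ft link x01).
exists w; split=> //; first exact: sP.
by move=> t /posw; have -> : e / 4 + e / 4 = e / 2 by lra.
Qed.

Theorem theorem11 (R : realType) (f : R -> R)
    (f_map : interval_map f) (f_type1 : sharkovskii_type1 f) :
  [/\ hpol f = nat_sup R (chain_lengths f),
      nat_sup R (chain_lengths f) = nat_sup R (horseshoe_orders f),
      nat_sup R (horseshoe_orders f) = nat_sup R (itv_horseshoe_orders f),
      natbar R (hpol f)
    & hpol f \is a fin_num -> exists k : nat, hpol f = (k%:R)%:E].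
Proof.
have ft := type1_mapP f_map f_type1.
(* The equalities follow from a cycle of inequalities: entropy, chains, interval horseshoes,
   horseshoes, entropy. Here, if the supremum is a finite [l], there is no chain of length
   [l + 1]. *)
have hc : (hpol f <= nat_sup R (chain_lengths f))%E.
  have [->|[l lE]] := nat_sup_natbar R (chain_lengths f); first exact: leey.
  rewrite lE; apply: hpol_le_chain => // /(nat_sup_ub R).
  by rewrite lE lee_fin ler_nat ltnn.
have ci : (nat_sup R (chain_lengths f) <= nat_sup R (itv_horseshoe_orders f))%E.
  by apply: nat_sup_le => l; exact: chain_itv_horseshoe.
have ih : (nat_sup R (itv_horseshoe_orders f) <= nat_sup R (horseshoe_orders f))%E.
  by apply: nat_sup_le => l [n [n0 [A [hA _]]]]; exists n; split=> //; exists A.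
have hh : (nat_sup R (horseshoe_orders f) <= hpol f)%E.
  by apply: nat_sup_leP => [|l]; [exact: hpol_ge0|exact: hpol_ge_horseshoe].
have e1 : hpol f = nat_sup R (chain_lengths f).
  by apply/eqP; rewrite eq_le hc (le_trans ci (le_trans ih hh)).
have e2 : nat_sup R (chain_lengths f) = nat_sup R (horseshoe_orders f).
  by apply/eqP; rewrite eq_le (le_trans ci ih) -e1.
have e3 : nat_sup R (horseshoe_orders f) = nat_sup R (itv_horseshoe_orders f).
  by apply/eqP; rewrite eq_le ih andbT -e2.
have nb : natbar R (hpol f) by rewrite e1; exact: nat_sup_natbar.
by split=> // hfin; case: nb hfin => [->|].
Qed.
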